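(* Let $\Bbbk$ be a field, let $n\ge 1$ and $k\ge 1$, and let $\sigma=(f_1,\dots,f_k)$ be a sequence of algebraically independent homogeneous polynomials in $\Bbbk[x_0,\dots,x_n]$; put $d_i=\deg(f_i)-1$. Assume that $\mathrm{char}(\Bbbk)$ does not divide $\deg(f_i)$ for any $i=1,\dots,k$, and, if $\mathrm{char}(\Bbbk)>0$, assume that the Jacobian matrix of $\sigma$ has rank $k$. Let $\nabla(\sigma):\mathcal{O}_{\mathbb{P}^n}^{\oplus (n+1)}\to\bigoplus_{i=1}^k\mathcal{O}_{\mathbb{P}^n}(d_i)$ be the morphism given by the $k\times(n+1)$ Jacobian matrix, whose $i$-th row consists of the partial derivatives of $f_i$, and let $\mathcal{T}_\sigma=\ker(\nabla(\sigma))$. Let $\mathcal{E}$ be a reflexive sheaf on $\mathbb{P}^n$ of rank $n+1-k$ together with a morphism $\mathcal{E}\to\mathcal{T}_\sigma\subset\mathcal{O}_{\mathbb{P}^n}^{\oplus(n+1)}$, and let $$\theta:\mathcal{E}\oplus\mathcal{O}_{\mathbb{P}^n}(-1)\to\mathcal{O}_{\mathbb{P}^n}^{\oplus(n+1)}$$ be the morphism whose restriction to $\mathcal{E}$ is the given one and whose restriction to $\mathcal{O}_{\mathbb{P}^n}(-1)$ is the Euler derivation $(x_0,\dots,x_n)^t$. If there is $h\in\Bbbk^\times$ such that $$\gcd\Big(\bigwedge\theta\Big)\cdot\gcd\Big(\bigwedge\nabla(\sigma)\Big)=h\cdot\gcd\Big(\bigwedge\sigma\Big),$$ then $\mathcal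{T}_\sigma\simeq\mathcal{E}$.
   Context: For a morphism $f$ between reflexive sheaves on $\mathbb{P}^n$, $\bigwedge f$ denotes the collection of its maximal minors. For a matrix of homogeneous polynomials these are the usual maximal minors. For $\theta:\mathcal{F}\to\mathcal{O}_{\mathbb{P}^n}^{\oplus m}$ with $\mathcal{F}$ reflexive of rank $r\le m$, $\bigwedge\theta$ is the map $\bigwedge^r\theta:\det(\mathcal{F})=(\bigwedge^r\mathcal{F})^{\vee\vee}\to\bigwedge^r\mathcal{O}_{\mathbb{P}^n}^{\oplus m}$ between direct sums of line bundles, i.e. a tuple of homogeneous polynomials of the same degree. The symbol $\gcd(\bigwedge f)$ is the greatest common divisor of these polynomials, a homogeneous polynomial defined up to a nonzero scalar (and equal to $0$ if all of them vanish). In $\bigwedge\sigma$, the sequence $\sigma$ is viewed as the $k\times 1$ matrix $(f_1,\dots,f_k)^t:\mathcal{O}_{\mathbb{P}^n}(-1)\to\bigoplus_{i=1}^k\mathcal{O}_{\mathbb{P}^n}(d_i)$, so that $\gcd(\bigwedge\sigma)=\gcd(f_1,\dots,f_k)$. *)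

(* Defs.v *)
From HB Require Import structures.
From mathcomp Require Import all_boot all_order all_algebra.
From mathcomp Require Import ring_quotient fraction boolp.
From mathcomp Require Import mpoly.

Set Implicit Arguments.
Unset Strict Implicit.
Unset Printing Implicit Defensive.

Import GRing.Theory.
Local Open Scope ring_scope.

(* Sheaves of modules on the scheme P^n = Proj k[x_0, ..., x_n], over the
   space of its homogeneous primes.  As k[x_0, ..., x_n] is a domain, the
   stalks of O(d) are realised inside its fraction field K. *)

Section ProjectiveSpace.
Variables (k : fieldType) (n : nat).

Local Notation S := {mpoly k[n.+1]}.
Local Notation K := {fraction S}.
Local Notation "p %:F" := (FracField.tofrac p).

Record pt := Pt {
  pt_ideal : {pred S};
  pt_idealP : idealr_closed pt_ideal;
  pt_prime : prime_idealr_closed pt_ideal;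
  pt_homog : forall d f, f \in pt_ideal -> pihomog mdeg d f \in pt_ideal;
  pt_relevant : exists i, 'X_i \notin pt_ideal
}.

Definition nonvanish (x : pt) (f : S) : Prop := f \notin pt_ideal x.

(* Zariski topology: the sets D_+(f) with f homogeneous form a base. *)
Record opn := Opn {
  opn_in :> pt -> Prop;
  opn_open : forall x, opn_in x -> exists f d,
    [/\ f \is d.-homog, nonvanish x f & forall y, nonvanish y f -> opn_in y]
}.

Definition opn_le (V U : opn) : Prop := forall x, V x -> U x.
Local Notation "V `<=` U" := (opn_le V U) (at level 70, no associativity).

Lemma opn_le_refl U : U `<=` U. Proof. by []. Qed.

Lemma opn_le_trans U V W : V `<=` U -> W `<=` V -> W `<=` U.
Proof. by move=> VU WV x /WV/VU. Qed.

Definition opn_pt (U : opn) := {x : pt | U x}.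

Definition opn_ptW U V (VU : V `<=` U) (x : opn_pt V) : opn_pt U :=
  exist _ (sval x) (VU _ (svalP x)).

Lemma nonvanishM x f g :
  nonvanish x (f * g) <-> nonvanish x f /\ nonvanish x g.
Proof.
rewrite /nonvanish; case: x => I [I0 _ Iid] Ip /= _ _.
have Il a b : b \in I -> a * b \in I.
  by move=> bI; rewrite -[_ * _]addr0 Iid.
split=> [fgI|[fI gI]].
  split; apply/negP => hI; move/negP: fgI; apply; last exact: Il.
  by rewrite mulrC Il.
by apply/negP => /Ip; rewrite (negbTE fI) (negbTE gI).
Qed.

Lemma nonvanish1 x : nonvanish x 1.
Proof. by rewrite /nonvanish; case: x => I []. Qed.

Lemma nonvanishXn x f m : nonvanish x f -> nonvanish x (f ^+ m).
Proof.
move=> xf; elim: m => [|m IH]; first by rewrite expr0; exact: nonvanish1.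
by rewrite exprS; apply/nonvanishM.
Qed.

Lemma nonvanish_neq0 x f : nonvanish x f -> f%:F != 0.
Proof.
case: x => I [I0 ? ?] ? ? ?; rewrite /nonvanish/= => fI.
by rewrite tofrac_eq0; apply: contraNneq fI => ->.
Qed.

Fact opnD_subproof f d (fd : f \is d.-homog) x : nonvanish x f ->
  exists g e, [/\ g \is e.-homog, nonvanish x g &
    forall y, nonvanish y g -> nonvanish y f].
Proof. by move=> xf; exists f, d. Qed.

Definition opnD f d (fd : f \is d.-homog) := Opn (opnD_subproof fd).

Fact opnI_subproof (U V : opn) x : U x /\ V x -> exists f d,
  [/\ f \is d.-homog, nonvanish x f &
      forall y, nonvanish y f -> U y /\ V y].
Proof.
case=> /opn_open[f [d [fd xf fU]]] /opn_open[g [e [ge xg gV]]].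
exists (f * g), (d + e)%N; split; first exact: dhomogM.
  exact/nonvanishM.
by move=> y /nonvanishM[yf yg]; split; [exact: fU|exact: gV].
Qed.

Definition opnI (U V : opn) := Opn (@opnI_subproof U V).

(* Sections of O(d): functions that are locally fractions a / b with a, b
   homogeneous, deg a = deg b + d, and b vanishing nowhere. *)
Definition regular (d : int) (U : opn) (s : opn_pt U -> K) : Prop :=
  forall x : opn_pt U, exists2 V : opn, V (sval x) &
  exists a b : S, exists i j : nat,
    [/\ a \is i.-homog, b \is j.-homog, i%:Z = j%:Z + d &
        forall y : opn_pt U, V (sval y) ->
          nonvanish (sval y) b /\ s y = a%:F / b%:F].

Record twist (d : int) (U : opn) := Twist {
  tw_val :> opn_pt U -> K;
  tw_regular : regular d tw_val
}.

Lemma tw_ext d U (s t : twist d U) : (forall x, s x = t x) -> s = t.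
Proof.
case: s t => s sr [t tr] /= /funext st; rewrite -{}st in tr *.
by congr Twist; exact: Prop_irrelevance.
Qed.

Lemma regular0 d U : @regular d U (fun=> 0).
Proof.
move=> x; have [i xi] := pt_relevant (sval x).
have X1 : ('X_i : S) \is 1.-homog by rewrite dhomogX; apply/eqP; exact: mdeg1.
exists (opnD X1) => //.
have i0 : (0 <= `|d|%N%:Z + d)%R.
  rewrite abszE -[X in _ + X]opprK Num.Theory.subr_ge0.
  by rewrite -Num.Theory.normrN Num.Theory.ler_norm.
exists 0, ('X_i ^+ absz d), (absz ((absz d)%:Z + d)), (absz d); split.
- exact: dhomog0.
- by rewrite -[X in X.-homog]mul1n; exact: dhomogMn.
- by rewrite gez0_abs.
- by move=> y yi; rewrite tofrac0 mul0r; split=> //; exact: nonvanishXn.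
Qed.

Lemma regularD d U (s t : opn_pt U -> K) :
  regular d s -> regular d t -> regular d (fun x => s x + t x).
Proof.
move=> sr tr x.
have [V Vx [a [b [i [j [ai bj ij sab]]]]]] := sr x.
have [W Wx [c [e [l [m [cl em lm tce]]]]]] := tr x.
exists (opnI V W) => //.
exists (a * e + b * c), (b * e), (i + m)%N, (j + m)%N; split.
- apply: dhomogD; first exact: dhomogM.
  have -> : (i + m = j + l)%N.
    by apply/eqP; rewrite -eqz_nat !PoszD ij lm addrA addrAC.
  exact: dhomogM.
- exact: dhomogM.
- by rewrite !PoszD ij addrAC.
- move=> y [Vy Wy]; have [yb ->] := sab y Vy; have [ye ->] := tce y Wy.
  split; first exact/nonvanishM.
  have b0 := nonvanish_neq0 yb; have e0 := nonvanish_neq0 ye.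
  rewrite (addf_div _ _ b0 e0) tofracD !tofracM.
  by congr ((_ + _) / _); exact: mulrC.
Qed.

Lemma regularN d U (s : opn_pt U -> K) :
  regular d s -> regular d (fun x => - s x).
Proof.
move=> sr x; have [V Vx [a [b [i [j [ai bj ij sab]]]]]] := sr x.
exists V => //; exists (- a), b, i, j; split=> //; first by rewrite rpredN.
by move=> y Vy; have [yb ->] := sab y Vy; rewrite tofracN mulNr.
Qed.

Lemma regularM d e c U (s t : opn_pt U -> K) : d + e = c ->
  regular d s -> regular e t -> regular c (fun x => s x * t x).
Proof.
move=> <- sr tr x.
have [V Vx [a [b [i [j [ai bj ij sab]]]]]] := sr x.
have [W Wx [a' [b' [l [m [cl em lm tce]]]]]] := tr x.
exists (opnI V W) => //.
exists (a * a'), (b * b'), (i + l)%N, (j + m)%N; split.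
- exact: dhomogM.
- exact: dhomogM.
- by rewrite !PoszD ij lm addrACA.
- move=> y [Vy Wy]; have [yb ->] := sab y Vy; have [ye ->] := tce y Wy.
  split; first exact/nonvanishM.
  by rewrite mulf_div !tofracM.
Qed.

Lemma regular_tofrac (p : S) m d U : p \is m.-homog -> m%:Z = d ->
  @regular d U (fun=> p%:F).
Proof.
move=> pm md x; exists U; first exact: svalP.
exists p, 1, m, 0%N; split; rewrite ?add0r ?dhomog1//.
by move=> y _; split; [exact: nonvanish1|rewrite tofrac1 divr1].
Qed.

HB.instance Definition _ d U := gen_eqMixin (twist d U).
HB.instance Definition _ d U := gen_choiceMixin (twist d U).

Definition tw0 d U : twist d U := Twist (@regular0 d U).
Definition tw_add d U (s t : twist d U) : twist d U :=
  Twist (regularD (tw_regular s) (tw_regular t)).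
Definition tw_opp d U (s : twist d U) : twist d U :=
  Twist (regularN (tw_regular s)).

Fact tw_addA d U : associative (@tw_add d U).
Proof. by move=> s t u; apply: tw_ext => x /=; rewrite addrA. Qed.
Fact tw_addC d U : commutative (@tw_add d U).
Proof. by move=> s t; apply: tw_ext => x /=; rewrite addrC. Qed.
Fact tw_add0 d U : left_id (tw0 d U) (@tw_add d U).
Proof. by move=> s; apply: tw_ext => x /=; rewrite add0r. Qed.
Fact tw_addN d U : left_inverse (tw0 d U) (@tw_opp d U) (@tw_add d U).
Proof. by move=> s; apply: tw_ext => x /=; rewrite addNr. Qed.

HB.instance Definition _ d U := GRing.isZmodule.Build (twist d U)
  (@tw_addA d U) (@tw_addC d U) (@tw_add0 d U) (@tw_addN d U).

Definition regfun U := twist 0 U.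
HB.instance Definition _ U := GRing.Zmodule.on (regfun U).

Definition rf1 U : regfun U :=
  Twist (@regular_tofrac 1 0 0 U (dhomog1 _ _) erefl).
Definition tw_scale d U (a : regfun U) (s : twist d U) : twist d U :=
  Twist (regularM (add0r d) (tw_regular a) (tw_regular s)).

Fact rf_mulA U : associative (@tw_scale 0 U).
Proof. by move=> s t u; apply: tw_ext => x /=; rewrite mulrA. Qed.
Fact rf_mulC U : commutative (@tw_scale 0 U).
Proof. by move=> s t; apply: tw_ext => x /=; rewrite mulrC. Qed.
Fact rf_mul1 U : left_id (rf1 U) (@tw_scale 0 U).
Proof. by move=> s; apply: tw_ext => x /=; rewrite tofrac1 mul1r. Qed.
Fact rf_mulD U : left_distributive (@tw_scale 0 U) +%R.
Proof. by move=> s t u; apply: tw_ext => x /=; rewrite mulrDl. Qed.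

(* O(U) is the zero ring when U is empty, hence only a comPzRingType. *)
HB.instance Definition _ U := GRing.Zmodule_isComPzRing.Build (regfun U)
  (@rf_mulA U) (@rf_mulC U) (@rf_mul1 U) (@rf_mulD U).

Fact tw_scaleA d U a b (s : twist d U) :
  tw_scale a (tw_scale b s) = tw_scale (a * b) s.
Proof. by apply: tw_ext => x /=; rewrite mulrA. Qed.
Fact tw_scale1 d U : left_id 1 (@tw_scale d U).
Proof. by move=> s; apply: tw_ext => x /=; rewrite tofrac1 mul1r. Qed.
Fact tw_scaleDr d U : right_distributive (@tw_scale d U) +%R.
Proof. by move=> a s t; apply: tw_ext => x /=; rewrite mulrDr. Qed.
Fact tw_scaleDl d U (s : twist d U) :
  {morph (@tw_scale d U)^~ s : a b / a + b}.
Proof. by move=> a b; apply: tw_ext => x /=; rewrite mulrDl. Qed.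

HB.instance Definition _ d U := GRing.Zmodule_isLmodule.Build (regfun U)
  (twist d U) (@tw_scaleA d U) (@tw_scale1 d U) (@tw_scaleDr d U)
  (@tw_scaleDl d U).

Fact tw_res_subproof d U V (VU : V `<=` U) (s : twist d U) :
  regular d (fun x => s (opn_ptW VU x)).
Proof.
move=> x; have [W Wx [a [b [i [j [ai bj ij sab]]]]]] :=
  tw_regular s (opn_ptW VU x).
exists W => //; exists a, b, i, j; split=> // y Wy.
exact: (sab (opn_ptW VU y)).
Qed.

Definition tw_res d U V (VU : V `<=` U) (s : twist d U) : twist d V :=
  Twist (tw_res_subproof VU s).

Definition rf_res U V (VU : V `<=` U) : regfun U -> regfun V := tw_res VU.

Lemma rf_resD U V (VU : V `<=` U) (a b : regfun U) :
  rf_res VU (a + b) = rf_res VU a + rf_res VU b.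
Proof. exact: tw_ext. Qed.
Lemma rf_resM U V (VU : V `<=` U) (a b : regfun U) :
  rf_res VU (a * b) = rf_res VU a * rf_res VU b.
Proof. exact: tw_ext. Qed.
Lemma rf_res1 U V (VU : V `<=` U) : rf_res VU 1 = 1.
Proof. exact: tw_ext. Qed.
Lemma rf_resN1 U V (VU : V `<=` U) : rf_res VU (-1) = -1.
Proof. exact: tw_ext. Qed.

Lemma rf_res_det U V (VU : V `<=` U) r (A : 'M[regfun U]_r) :
  rf_res VU (\det A) = \det (map_mx (rf_res VU) A).
Proof.
pose f : regfun U -> regfun V := rf_res VU.
have f_add : zmod_morphism f by move=> a b; exact: tw_ext.
have f_mul : monoid_morphism f by split=> [|a b]; exact: tw_ext.
pose fA := GRing.isZmodMorphism.Build _ _ f f_add.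
pose fM := GRing.isMonoidMorphism.Build _ _ f f_mul.
pose fR : {rmorphism regfun U -> regfun V} := HB.pack f fA fM.
exact/esym/(det_map_mx fR).
Qed.

(* Presheaves of O-modules; [is_sheaf] below is the sheaf condition. *)
Record pmod := Pmod {
  sec :> forall U : opn, lmodType (regfun U);
  res : forall U V, V `<=` U -> sec U -> sec V;
  res_linear : forall U V (VU : V `<=` U) (a : regfun U) (s t : sec U),
    res VU (a *: s + t) = rf_res VU a *: res VU s + res VU t;
  res_id : forall U (UU : U `<=` U) (s : sec U), res UU s = s;
  res_comp : forall U V W (VU : V `<=` U) (WV : W `<=` V) (WU : W `<=` U)
    (s : sec U), res WV (res VU s) = res WU s
}.
Arguments res F {U V} VU s : rename.

Implicit Types F G H : pmod.

Definition is_sheaf (F : pmod) : Prop :=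
  forall (U : opn) (I : Type) (V : I -> opn) (VU : forall i, V i `<=` U),
  (forall x, U x -> exists i, V i x) ->
  forall s : forall i, F (V i),
  (forall i j (W : opn) (Wi : W `<=` V i) (Wj : W `<=` V j),
     res F Wi (s i) = res F Wj (s j)) ->
  exists! t : F U, forall i, res F (VU i) t = s i.

Record mor (F G : pmod) := Mor {
  app :> forall U, F U -> G U;
  app_linear : forall U, linear (@app U);
  app_res : forall U V (VU : V `<=` U) (s : F U),
    app (res F VU s) = res G VU (app s)
}.

HB.instance Definition _ F G (f : mor F G) U :=
  GRing.isLinear.Build (regfun U) (F U) (G U) *:%R (@app _ _ f U)
    (@app_linear _ _ f U).

Definition is_iso F G (f : mor F G) : Prop := forall U, bijective (f U).
Definition isomorphic F G : Prop := exists f : mor F G, is_iso f.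

Lemma resD F U V (VU : V `<=` U) (s t : F U) :
  res F VU (s + t) = res F VU s + res F VU t.
Proof.
rewrite -[s]scale1r res_linear; congr (_ + _).
by rewrite scale1r [rf_res _ _](_ : _ = 1) ?scale1r//; exact: tw_ext.
Qed.

Lemma res0 F U V (VU : V `<=` U) : res F VU 0 = 0.
Proof. by apply: (addrI (res F VU 0)); rewrite -resD !addr0. Qed.

Lemma resZ F U V (VU : V `<=` U) (a : regfun U) (s : F U) :
  res F VU (a *: s) = rf_res VU a *: res F VU s.
Proof. by rewrite -[_ *: s]addr0 res_linear res0 addr0. Qed.

Lemma res_sum F U V (VU : V `<=` U) I (r : seq I) P (s : I -> F U) :
  res F VU (\sum_(i <- r | P i) s i) = \sum_(i <- r | P i) res F VU (s i).
Proof.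
exact: (big_morph (res F VU) (fun s t => resD VU s t) (res0 F VU)).
Qed.

Fact comp_linear F G H (g : mor G H) (f : mor F G) U :
  linear (fun s => g U (f U s)).
Proof. by move=> a s t; rewrite !linearP. Qed.
Fact comp_res F G H (g : mor G H) (f : mor F G) U V (VU : V `<=` U) s :
  g V (f V (res F VU s)) = res H VU (g U (f U s)).
Proof. by rewrite !app_res. Qed.
Definition mor_comp F G H (g : mor G H) (f : mor F G) : mor F H :=
  Mor (comp_linear g f) (comp_res g f).

Fact Otw_linear d U V (VU : V `<=` U) (a : regfun U) (s t : twist d U) :
  tw_res VU (a *: s + t) = rf_res VU a *: tw_res VU s + tw_res VU t.
Proof. exact: tw_ext. Qed.
Fact Otw_id d U (UU : U `<=` U) (s : twist d U) : tw_res UU s = s.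
Proof.
apply: tw_ext => -[x Ux] /=; congr (tw_val s _); congr (exist _ x _).
exact: Prop_irrelevance.
Qed.
Fact Otw_comp d U V W (VU : V `<=` U) (WV : W `<=` V) (WU : W `<=` U)
  (s : twist d U) : tw_res WV (tw_res VU s) = tw_res WU s.
Proof.
apply: tw_ext => -[x Wx] /=; congr (tw_val s _); congr (exist _ x _).
exact: Prop_irrelevance.
Qed.

Definition Otwist (d : int) : pmod :=
  @Pmod (twist d) (@tw_res d) (@Otw_linear d) (@Otw_id d) (@Otw_comp d).

Section Sum2.
Variables F G : pmod.
Let s2 U : lmodType (regfun U) := (F U * G U)%type.
Let s2_res U V (VU : V `<=` U) (s : s2 U) : s2 V :=
  (res F VU s.1, res G VU s.2).
Fact sum2_linear U V (VU : V `<=` U) (a : regfun U) (s t : s2 U) :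
  s2_res VU (a *: s + t) = rf_res VU a *: s2_res VU s + s2_res VU t.
Proof. by rewrite /s2_res /= !res_linear. Qed.
Fact sum2_id U (UU : U `<=` U) (s : s2 U) : s2_res UU s = s.
Proof. by rewrite /s2_res !res_id; case: s. Qed.
Fact sum2_comp U V W (VU : V `<=` U) (WV : W `<=` V) (WU : W `<=` U)
  (s : s2 U) : s2_res WV (s2_res VU s) = s2_res WU s.
Proof. by rewrite /s2_res /= (res_comp VU WV WU) (res_comp VU WV WU). Qed.
Definition sum2 : pmod := Pmod sum2_linear sum2_id sum2_comp.

Variables (H : pmod) (f : mor F H) (g : mor G H).
Let cp U (s : sum2 U) : H U := f U s.1 + g U s.2.
Fact copair_linear U : linear (@cp U).
Proof. by move=> a s t; rewrite /cp /= !linearP scalerDr addrACA. Qed.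
Fact copair_res U V (VU : V `<=` U) (s : sum2 U) :
  cp (res sum2 VU s) = res H VU (cp s).
Proof. by rewrite /cp resD !app_res. Qed.
Definition copair : mor sum2 H := Mor copair_linear copair_res.
End Sum2.

Definition dprod m U (F : 'I_m -> pmod) := forall i, F i U.

Section SumN.
Variables (m : nat) (F : 'I_m -> pmod).
Implicit Types U V W : opn.

Lemma dprod_ext U (s t : dprod U F) : (forall i, s i = t i) -> s = t.
Proof. exact: functional_extensionality_dep. Qed.

HB.instance Definition _ U := Choice.on (dprod U F).

Let dadd U (s t : dprod U F) : dprod U F := fun i => s i + t i.
Let dopp U (s : dprod U F) : dprod U F := fun i => - s i.
Let d0 U : dprod U F := fun i => 0.

Fact dprod_addA U : associative (@dadd U).
Proof. by move=> s t u; apply: dprod_ext => i; rewrite /dadd addrA. Qed.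
Fact dprod_addC U : commutative (@dadd U).
Proof. by move=> s t; apply: dprod_ext => i; rewrite /dadd addrC. Qed.
Fact dprod_add0 U : left_id (d0 U) (@dadd U).
Proof. by move=> s; apply: dprod_ext => i; rewrite /dadd add0r. Qed.
Fact dprod_addN U : left_inverse (d0 U) (@dopp U) (@dadd U).
Proof. by move=> s; apply: dprod_ext => i; rewrite /dadd addNr. Qed.
HB.instance Definition _ U := GRing.isZmodule.Build (dprod U F)
  (@dprod_addA U) (@dprod_addC U) (@dprod_add0 U) (@dprod_addN U).

Let dscale U (a : regfun U) (s : dprod U F) : dprod U F := fun i => a *: s i.
Fact dprod_scaleA U a b (s : dprod U F) :
  dscale a (dscale b s) = dscale (a * b) s.
Proof. by apply: dprod_ext => i; rewrite /dscale scalerA. Qed.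
Fact dprod_scale1 U : left_id 1 (@dscale U).
Proof. by move=> s; apply: dprod_ext => i; rewrite /dscale scale1r. Qed.
Fact dprod_scaleDr U : right_distributive (@dscale U) +%R.
Proof. by move=> a s t; apply: dprod_ext => i; rewrite /dscale scalerDr. Qed.
Fact dprod_scaleDl U (s : dprod U F) : {morph (@dscale U)^~ s : a b / a + b}.
Proof. by move=> a b; apply: dprod_ext => i; rewrite /dscale scalerDl. Qed.
HB.instance Definition _ U := GRing.Zmodule_isLmodule.Build (regfun U)
  (dprod U F) (@dprod_scaleA U) (@dprod_scale1 U) (@dprod_scaleDr U)
  (@dprod_scaleDl U).

Let dres U V (VU : V `<=` U) (s : dprod U F) : dprod V F :=
  fun i => res (F i) VU (s i).
Fact sumn_linear U V (VU : V `<=` U) (a : regfun U) (s t : dprod U F) :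
  dres VU (a *: s + t) = rf_res VU a *: dres VU s + dres VU t.
Proof. by apply: dprod_ext => i; rewrite /dres res_linear. Qed.
Fact sumn_id U (UU : U `<=` U) (s : dprod U F) : dres UU s = s.
Proof. by apply: dprod_ext => i; rewrite /dres res_id. Qed.
Fact sumn_comp U V W (VU : V `<=` U) (WV : W `<=` V) (WU : W `<=` U)
  (s : dprod U F) : dres WV (dres VU s) = dres WU s.
Proof. by apply: dprod_ext => i; rewrite /dres (res_comp VU WV WU). Qed.
Definition dsum : pmod :=
  @Pmod (fun U => dprod U F) dres sumn_linear sumn_id sumn_comp.

Variable H : pmod.

Section Tuple.
Variable f : forall i, mor H (F i).
Let tp U (s : H U) : dsum U := fun i => f i U s.
Fact tuple_linear U : linear (@tp U).
Proof. by move=> a s t; apply: dprod_ext => i; rewrite /tp linearP. Qed.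
Fact tuple_res U V (VU : V `<=` U) (s : H U) :
  tp (res H VU s) = res dsum VU (tp s).
Proof. by apply: dprod_ext => i; rewrite /tp app_res. Qed.
Definition mor_tuple : mor H dsum := Mor tuple_linear tuple_res.
End Tuple.

Section Cotuple.
Variable f : forall i, mor (F i) H.
Let ct U (s : dsum U) : H U := \sum_i f i U (s i).
Fact cotuple_linear U : linear (@ct U).
Proof.
move=> a s t; rewrite /ct scaler_sumr -big_split; apply: eq_bigr => i _ /=.
by rewrite -linearP.
Qed.
Fact cotuple_res U V (VU : V `<=` U) (s : dsum U) :
  ct (res dsum VU s) = res H VU (ct s).
Proof. by rewrite /ct res_sum; apply: eq_bigr => i _; rewrite -app_res. Qed.
Definition mor_cotuple : mor dsum H := Mor cotuple_linear cotuple_res.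
End Cotuple.
End SumN.

Definition Ofree (m : nat) : pmod := dsum (fun _ : 'I_m => Otwist 0).

(* The polynomials that are homogeneous of degree d for an integer d; only
   0 if d < 0. *)
Definition homogz (d : int) (p : S) : Prop :=
  p = 0 \/ exists2 m : nat, m%:Z = d & p \is m.-homog.

Section PolyMor.
Variables (c d : int) (p : S) (p_homog : homogz (d - c) p).

Fact polymor_subproof U (s : twist c U) : regular d (fun x => p%:F * s x).
Proof.
case: p_homog => [->|[m mdc pm]].
  rewrite (_ : (fun x => _) = (fun=> 0)); first exact: regular0.
  by apply: functional_extensionality_dep => x; rewrite tofrac0 mul0r.
apply: (@regularM (d - c) c) (tw_regular s); first by rewrite subrK.
exact: regular_tofrac pm mdc.
Qed.
Let pm U (s : Otwist c U) : Otwist d U := Twist (polymor_subproof s).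
Fact polymor_linear U : linear (@pm U).
Proof. by move=> a s t; apply: tw_ext => x /=; rewrite mulrDr mulrCA. Qed.
Fact polymor_res U V (VU : V `<=` U) (s : Otwist c U) :
  pm (res (Otwist c) VU s) = res (Otwist d) VU (pm s).
Proof. exact: tw_ext. Qed.
Definition polymor : mor (Otwist c) (Otwist d) := Mor polymor_linear polymor_res.
End PolyMor.

Definition mxmor a b (c : 'I_a -> int) (d : 'I_b -> int) (A : 'M[S]_(b, a))
    (A_homog : forall i j, homogz (d i - c j) (A i j)) :
    mor (dsum (fun j => Otwist (c j))) (dsum (fun i => Otwist (d i))) :=
  mor_tuple (fun i => mor_cotuple (fun j => polymor (A_homog i j))).

Section Kernel.
Variables (F G : pmod) (f : mor F G).

Definition ker_pred U := [pred s : F U | f U s == 0].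

Fact ker_submod U : submod_closed (ker_pred U).
Proof.
split=> [|a s t]; rewrite !inE ?linear0// => /eqP s0 /eqP t0.
by rewrite linearP /= s0 t0 scaler0 addr0.
Qed.
HB.instance Definition _ U :=
  GRing.isSubmodClosed.Build (regfun U) (F U) (ker_pred U) (ker_submod U).

Record ker_sec U := KerSec {
  ker_val : F U;
  ker_valP : ker_val \in ker_pred U
}.
HB.instance Definition _ U := [isSub for @ker_val U].
HB.instance Definition _ U := [Choice of ker_sec U by <:].
HB.instance Definition _ U := [SubChoice_isSubLmodule of ker_sec U by <:].

Fact ker_res_subproof U V (VU : V `<=` U) (s : ker_sec U) :
  res F VU (ker_val s) \in ker_pred V.
Proof. by case: s => s /=; rewrite !inE app_res => /eqP ->; rewrite res0. Qed.
Let kres U V (VU : V `<=` U) (s : ker_sec U) : ker_sec V :=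
  KerSec (ker_res_subproof VU s).
Fact ker_linear U V (VU : V `<=` U) (a : regfun U) (s t : ker_sec U) :
  kres VU (a *: s + t) = rf_res VU a *: kres VU s + kres VU t.
Proof. by apply: val_inj; rewrite /= res_linear. Qed.
Fact ker_id U (UU : U `<=` U) (s : ker_sec U) : kres UU s = s.
Proof. by apply: val_inj; rewrite /= res_id. Qed.
Fact ker_comp U V W (VU : V `<=` U) (WV : W `<=` V) (WU : W `<=` U)
  (s : ker_sec U) : kres WV (kres VU s) = kres WU s.
Proof. by apply: val_inj; rewrite /= (res_comp VU WV WU). Qed.
Definition kernel : pmod := @Pmod ker_sec kres ker_linear ker_id ker_comp.

Definition ker_incl : mor kernel F :=
  @Mor kernel F ker_val (fun=> fun=> fun=> fun=> erefl)
    (fun=> fun=> fun=> fun=> erefl).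
End Kernel.

(* Sections over U of Hom(F, G): morphisms F|_U -> G|_U. *)
Section Hom.
Variables F G : pmod.

Record hom_sec U := HomSec {
  hom_app :> forall V, V `<=` U -> F V -> G V;
  hom_linear : forall V (VU : V `<=` U), linear (hom_app VU);
  hom_res : forall V W (VU : V `<=` U) (WV : W `<=` V) (WU : W `<=` U)
    (s : F V), hom_app WU (res F WV s) = res G WV (hom_app VU s)
}.

Lemma hom_ext U (f g : hom_sec U) :
  (forall V VU s, f V VU s = g V VU s) -> f = g.
Proof.
case: f g => f fl fr [g gl gr] /= fg.
have {}fg : f = g.
  apply: functional_extensionality_dep => V.
  apply: functional_extensionality_dep => VU.
  by apply: functional_extensionality_dep => s.
by rewrite -{}fg in gl gr *; congr HomSec; exact: Prop_irrelevance.
Qed.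

HB.instance Definition _ U := gen_eqMixin (hom_sec U).
HB.instance Definition _ U := gen_choiceMixin (hom_sec U).

Program Definition hom0 U : hom_sec U :=
  @HomSec U (fun _ _ _ => 0) _ _.
Next Obligation. by move=> a s t; rewrite scaler0 addr0. Qed.
Next Obligation. by rewrite res0. Qed.

Program Definition hom_add U (f g : hom_sec U) : hom_sec U :=
  @HomSec U (fun V VU s => f V VU s + g V VU s) _ _.
Next Obligation. by move=> a s t; rewrite !hom_linear scalerDr addrACA. Qed.
Next Obligation. by rewrite resD !(hom_res _ VU WV WU). Qed.

Program Definition hom_scale U (a : regfun U) (f : hom_sec U) : hom_sec U :=
  @HomSec U (fun V VU s => rf_res VU a *: f V VU s) _ _.
Next Obligation.
by move=> b s t; rewrite hom_linear scalerDr !scalerA [b * _]mulrC.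
Qed.
Next Obligation.
rewrite resZ (hom_res _ VU WV WU); congr (_ *: _).
by rewrite /rf_res (Otw_comp VU WV WU).
Qed.

Fact hom_addA U : associative (@hom_add U).
Proof. by move=> f g h; apply: hom_ext => V VU s /=; rewrite addrA. Qed.
Fact hom_addC U : commutative (@hom_add U).
Proof. by move=> f g; apply: hom_ext => V VU s /=; rewrite addrC. Qed.
Fact hom_add0 U : left_id (hom0 U) (@hom_add U).
Proof. by move=> f; apply: hom_ext => V VU s /=; rewrite add0r. Qed.
Fact hom_addN U : left_inverse (hom0 U) (hom_scale (-1)) (@hom_add U).
Proof.
by move=> f; apply: hom_ext => V VU s /=; rewrite rf_resN1 scaleN1r addNr.
Qed.
HB.instance Definition _ U := GRing.isZmodule.Build (hom_sec U)
  (@hom_addA U) (@hom_addC U) (@hom_add0 U) (@hom_addN U).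

Fact hom_scaleA U a b (f : hom_sec U) :
  hom_scale a (hom_scale b f) = hom_scale (a * b) f.
Proof. by apply: hom_ext => V VU s /=; rewrite scalerA rf_resM. Qed.
Fact hom_scale1 U : left_id 1 (@hom_scale U).
Proof. by move=> f; apply: hom_ext => V VU s /=; rewrite rf_res1 scale1r. Qed.
Fact hom_scaleDr U : right_distributive (@hom_scale U) +%R.
Proof. by move=> a f g; apply: hom_ext => V VU s /=; rewrite scalerDr. Qed.
Fact hom_scaleDl U (f : hom_sec U) :
  {morph (@hom_scale U)^~ f : a b / a + b}.
Proof. by move=> a b; apply: hom_ext => V VU s /=; rewrite rf_resD scalerDl. Qed.
HB.instance Definition _ U := GRing.Zmodule_isLmodule.Build (regfun U)
  (hom_sec U) (@hom_scaleA U) (@hom_scale1 U) (@hom_scaleDr U) (@hom_scaleDl U).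

Program Definition hom_restr U V (VU : V `<=` U) (f : hom_sec U) : hom_sec V :=
  @HomSec V (fun W WV => f W (opn_le_trans VU WV)) _ _.
Next Obligation. exact: hom_linear. Qed.
Next Obligation. exact: hom_res. Qed.

Fact homp_linear U V (VU : V `<=` U) (a : regfun U) (f g : hom_sec U) :
  hom_restr VU (a *: f + g) = rf_res VU a *: hom_restr VU f + hom_restr VU g.
Proof.
apply: hom_ext => W WV s /=; congr (_ *: _ + _).
by rewrite /rf_res (Otw_comp _ _ (opn_le_trans VU WV)).
Qed.
Fact homp_id U (UU : U `<=` U) (f : hom_sec U) : hom_restr UU f = f.
Proof.
by apply: hom_ext => V VU s /=; congr (hom_app f _ s); exact: Prop_irrelevance.
Qed.
Fact homp_comp U V W (VU : V `<=` U) (WV : W `<=` V) (WU : W `<=` U)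
  (f : hom_sec U) : hom_restr WV (hom_restr VU f) = hom_restr WU f.
Proof.
by apply: hom_ext => X XW s /=; congr (hom_app f _ s); exact: Prop_irrelevance.
Qed.
Definition shom : pmod := @Pmod hom_sec hom_restr homp_linear homp_id homp_comp.
End Hom.

Definition sdual (F : pmod) : pmod := shom F (Otwist 0).

Section Evaluation.
Variable F : pmod.

Program Definition ev_sec U (s : F U) : sdual (sdual F) U :=
  @HomSec (sdual F) (Otwist 0) U
    (fun V VU f => hom_app f (@opn_le_refl V) (res F VU s)) _ _.
Next Obligation. by move=> a f g /=; rewrite /rf_res Otw_id. Qed.
Next Obligation.
by rewrite -(res_comp VU WV WU); exact: (hom_res s0 (@opn_le_refl V) WV).
Qed.
Fact ev_linear U : linear (@ev_sec U).
Proof.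
move=> a s t; apply: hom_ext => V VU f /=.
by rewrite res_linear hom_linear.
Qed.
Fact ev_res U V (VU : V `<=` U) (s : F U) :
  ev_sec (res F VU s) = res (sdual (sdual F)) VU (ev_sec s).
Proof.
by apply: hom_ext => W WV f /=; rewrite (res_comp _ _ (opn_le_trans VU WV)).
Qed.
Definition ev : mor F (sdual (sdual F)) := Mor ev_linear ev_res.
End Evaluation.

(* Sections over U of the dual of the r-th exterior power of F.  A morphism
   from that sheaf (the sheafification of V |-> Lambda^r F(V)) to O is the
   same as a family of alternating r-linear forms commuting with
   restriction. *)
Section AlternatingForms.
Variables (r : nat) (F : pmod).

Definition upd T (v : 'I_r -> T) (i : 'I_r) (x : T) : 'I_r -> T :=
  fun j => if j == i then x else v j.

#[local] Obligation Tactic := idtac.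

Record alt_sec U := AltSec {
  alt_app :> forall V, V `<=` U -> ('I_r -> F V) -> Otwist 0 V;
  alt_linear : forall V (VU : V `<=` U) (v : 'I_r -> F V) i,
    linear (fun s => alt_app VU (upd v i s));
  alt_alternate : forall V (VU : V `<=` U) (v : 'I_r -> F V) i j,
    i != j -> v i = v j -> alt_app VU v = 0;
  alt_res : forall V W (VU : V `<=` U) (WV : W `<=` V) (WU : W `<=` U)
    (v : 'I_r -> F V),
    alt_app WU (fun i => res F WV (v i)) = res (Otwist 0) WV (alt_app VU v)
}.

Lemma alt_ext U (f g : alt_sec U) :
  (forall V VU v, f V VU v = g V VU v) -> f = g.
Proof.
case: f g => f fl fa fr [g gl ga gr] /= fg.
have {}fg : f = g.
  apply: functional_extensionality_dep => V.
  apply: functional_extensionality_dep => VU.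
  by apply: funext => v; exact: fg.
by rewrite -{}fg in gl ga gr *; congr AltSec; exact: Prop_irrelevance.
Qed.

HB.instance Definition _ U := gen_eqMixin (alt_sec U).
HB.instance Definition _ U := gen_choiceMixin (alt_sec U).

Program Definition alt0 U : alt_sec U := @AltSec U (fun _ _ _ => 0) _ _ _.
Next Obligation. by move=> U V VU v i a s t; rewrite scaler0 addr0. Qed.
Next Obligation. by []. Qed.
Next Obligation. by move=> U V W VU WV WU v; rewrite res0. Qed.

Program Definition alt_add U (f g : alt_sec U) : alt_sec U :=
  @AltSec U (fun V VU v => f V VU v + g V VU v) _ _ _.
Next Obligation.
by move=> U f g V VU v i a s t; rewrite !alt_linear scalerDr addrACA.
Qed.
Next Obligation.
by move=> U f g V VU v i j ij vij; rewrite /= !(alt_alternate _ _ ij vij) addr0.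
Qed.
Next Obligation.
by move=> U f g V W VU WV WU v; rewrite resD !(alt_res _ VU WV WU).
Qed.

Program Definition alt_scale U (a : regfun U) (f : alt_sec U) : alt_sec U :=
  @AltSec U (fun V VU v => rf_res VU a *: f V VU v) _ _ _.
Next Obligation.
move=> U a f V VU v i b s t.
by rewrite alt_linear scalerDr !scalerA [b * _]mulrC.
Qed.
Next Obligation.
move=> U a f V VU v i j ij vij.
by rewrite /= (alt_alternate _ _ ij vij) scaler0.
Qed.
Next Obligation.
move=> U a f V W VU WV WU v.
rewrite resZ (alt_res _ VU WV WU); congr (_ *: _).
by rewrite /rf_res (Otw_comp VU WV WU).
Qed.

Fact alt_addA U : associative (@alt_add U).
Proof. by move=> f g h; apply: alt_ext => V VU v /=; rewrite addrA. Qed.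
Fact alt_addC U : commutative (@alt_add U).
Proof. by move=> f g; apply: alt_ext => V VU v /=; rewrite addrC. Qed.
Fact alt_add0 U : left_id (alt0 U) (@alt_add U).
Proof. by move=> f; apply: alt_ext => V VU v /=; rewrite add0r. Qed.
Fact alt_addN U : left_inverse (alt0 U) (alt_scale (-1)) (@alt_add U).
Proof.
by move=> f; apply: alt_ext => V VU v /=; rewrite rf_resN1 scaleN1r addNr.
Qed.
HB.instance Definition _ U := GRing.isZmodule.Build (alt_sec U)
  (@alt_addA U) (@alt_addC U) (@alt_add0 U) (@alt_addN U).

Fact alt_scaleA U a b (f : alt_sec U) :
  alt_scale a (alt_scale b f) = alt_scale (a * b) f.
Proof. by apply: alt_ext => V VU v /=; rewrite scalerA rf_resM. Qed.
Fact alt_scale1 U : left_id 1 (@alt_scale U).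
Proof. by move=> f; apply: alt_ext => V VU v /=; rewrite rf_res1 scale1r. Qed.
Fact alt_scaleDr U : right_distributive (@alt_scale U) +%R.
Proof. by move=> a f g; apply: alt_ext => V VU v /=; rewrite scalerDr. Qed.
Fact alt_scaleDl U (f : alt_sec U) :
  {morph (@alt_scale U)^~ f : a b / a + b}.
Proof. by move=> a b; apply: alt_ext => V VU v /=; rewrite rf_resD scalerDl. Qed.
HB.instance Definition _ U := GRing.Zmodule_isLmodule.Build (regfun U)
  (alt_sec U) (@alt_scaleA U) (@alt_scale1 U) (@alt_scaleDr U) (@alt_scaleDl U).

Program Definition alt_restr U V (VU : V `<=` U) (f : alt_sec U) : alt_sec V :=
  @AltSec V (fun W WV => f W (opn_le_trans VU WV)) _ _ _.
Next Obligation. by move=> U V VU f W WV v i; exact: alt_linear. Qed.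
Next Obligation.
by move=> U V VU f W WV v i j ij vij; exact: alt_alternate ij vij.
Qed.
Next Obligation. by move=> U V VU f W X WV XW XV v; exact: alt_res. Qed.

Fact altp_linear U V (VU : V `<=` U) (a : regfun U) (f g : alt_sec U) :
  alt_restr VU (a *: f + g) = rf_res VU a *: alt_restr VU f + alt_restr VU g.
Proof.
apply: alt_ext => W WV v /=; congr (_ *: _ + _).
by rewrite /rf_res (Otw_comp _ _ (opn_le_trans VU WV)).
Qed.
Fact altp_id U (UU : U `<=` U) (f : alt_sec U) : alt_restr UU f = f.
Proof.
by apply: alt_ext => V VU v /=; congr (alt_app f _ v); exact: Prop_irrelevance.
Qed.
Fact altp_comp U V W (VU : V `<=` U) (WV : W `<=` V) (WU : W `<=` U)
  (f : alt_sec U) : alt_restr WV (alt_restr VU f) = alt_restr WU f.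
Proof.
by apply: alt_ext => X XW v /=; congr (alt_app f _ v); exact: Prop_irrelevance.
Qed.
Definition dual_wedge : pmod :=
  @Pmod alt_sec alt_restr altp_linear altp_id altp_comp.

(* det F = (Lambda^r F)^vv for F of rank r. *)
Definition det_sheaf : pmod := sdual dual_wedge.
End AlternatingForms.

Section WedgeMorphism.
Variables (r m : nat) (F : pmod) (theta : mor F (Ofree m)) (g : 'I_r -> 'I_m).

Definition minor_mx U (v : 'I_r -> F U) : 'M[regfun U]_r :=
  \matrix_(i, j) (theta U (v j) : dprod U (fun=> Otwist 0)) (g i).

#[local] Obligation Tactic := idtac.

Fact det_minor_alternate U (v : 'I_r -> F U) i j :
  i != j -> v i = v j -> \det (minor_mx v) = 0.
Proof.
move=> ij vij; rewrite -det_tr.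
by apply: (determinant_alternate ij) => l; rewrite !mxE vij.
Qed.

Fact det_minor_res U V (VU : V `<=` U) (v : 'I_r -> F U) :
  \det (minor_mx (fun i => res F VU (v i))) = rf_res VU (\det (minor_mx v)).
Proof.
rewrite rf_res_det; apply: (congr1 determinant).
by apply/matrixP => i j; rewrite !mxE app_res.
Qed.

(* The g-th coordinate of Lambda^r theta, as a form on F. *)
Program Definition minor_form U : dual_wedge r F U :=
  @AltSec r F U (fun V VU v => \det (minor_mx v)) _ _ _.
Next Obligation.
move=> U V VU v i a s t; rewrite -!(det_tr (minor_mx _)).
rewrite (@determinant_multilinear _ _ _ (minor_mx (upd v i s))^T
  (minor_mx (upd v i t))^T i a 1) ?mul1r//.
- by apply/rowP => j; rewrite !mxE /upd eqxx linearP mul1r.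
- by apply/matrixP => j l; rewrite !mxE /upd eq_sym (negbTE (neq_lift _ _)).
- by apply/matrixP => j l; rewrite !mxE /upd eq_sym (negbTE (neq_lift _ _)).
Qed.
Next Obligation.
by move=> U V VU v i j; exact: det_minor_alternate.
Qed.
Next Obligation.
by move=> U V W VU WV WU v; exact: det_minor_res.
Qed.

Definition wedge_coord U (phi : det_sheaf r F U) : Otwist 0 U :=
  hom_app phi (@opn_le_refl U) (minor_form U).
Fact wedge_coord_linear U : linear (@wedge_coord U).
Proof. by move=> a s t; rewrite /wedge_coord /= /rf_res Otw_id. Qed.
Fact wedge_coord_res U V (VU : V `<=` U) (phi : det_sheaf r F U) :
  wedge_coord (res (det_sheaf r F) VU phi) = res (Otwist 0) VU (wedge_coord phi).
Proof.
rewrite -(hom_res phi (@opn_le_refl U) VU (opn_le_trans VU (@opn_le_refl V))).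
by congr (hom_app _ _ _); exact: alt_ext.
Qed.
Definition wedge_mor : mor (det_sheaf r F) (Otwist 0) :=
  Mor wedge_coord_linear wedge_coord_res.
End WedgeMorphism.

Definition increasing r m (g : 'I_r -> 'I_m) : Prop :=
  forall i j : 'I_r, (i < j)%N -> (g i < g j)%N.

(* The r x r minors of theta : F -> O^m, for F of rank r <= m: after a
   choice of an isomorphism O(c) = det F, the coordinates of Lambda^r theta
   are the multiplications by the polynomials p g. *)
Definition wedge_tuple r m F (theta : mor F (Ofree m))
    (p : ('I_r -> 'I_m) -> S) : Prop :=
  exists c (psi : mor (Otwist c) (det_sheaf r F)), is_iso psi /\
  forall g, increasing g -> forall U (s : Otwist c U) (x : opn_pt U),
    tw_val (wedge_mor theta g U (psi U s)) x = (p g)%:F * tw_val s x.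

Definition dvdmp (d q : S) : Prop := exists c, q = c * d.

Definition is_gcd (P : S -> Prop) (g : S) : Prop :=
  (forall q, P q -> dvdmp g q) /\
  (forall d, (forall q, P q -> dvdmp d q) -> dvdmp d g).

Definition is_gcd_wedge r m F (theta : mor F (Ofree m)) (q : S) : Prop :=
  exists2 p : ('I_r -> 'I_m) -> S, wedge_tuple theta p &
    is_gcd (fun f => exists2 g, increasing g & f = p g) q.

Definition maximal_minor a b (A : 'M[S]_(a, b)) (q : S) : Prop :=
  exists (f : 'I_(minn a b) -> 'I_a) (g : 'I_(minn a b) -> 'I_b),
    [/\ increasing f, increasing g & q = \det (mxsub f g A)].

(* Locally on P^n there is a presentation O^c -> O^b -> F -> 0. *)
Definition coherent F : Prop := forall x : pt, exists2 U : opn, U x &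
  exists b (e : 'I_b -> F U) c (R : 'I_c -> 'I_b -> regfun U),
  [/\ forall V (VU : V `<=` U) (s : F V) y, V y ->
        exists2 W : opn, W y & exists (WV : W `<=` V) (a : 'I_b -> regfun W),
          res F WV s = \sum_i a i *: res F (opn_le_trans VU WV) (e i),
      forall j, \sum_i R j i *: e i = 0 &
      forall V (VU : V `<=` U) (a : 'I_b -> regfun V),
        \sum_i a i *: res F VU (e i) = 0 -> forall y, V y ->
        exists2 W : opn, W y & exists (WV : W `<=` V) (l : 'I_c -> regfun W),
          forall i, rf_res WV (a i) =
            \sum_j l j * rf_res (opn_le_trans VU WV) (R j i)].

Definition reflexive_sheaf F : Prop :=
  [/\ is_sheaf F, coherent F & is_iso (ev F)].

Definition nonempty (U : opn) : Prop := exists x, U x.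

(* The germs at the generic point of e_1, ..., e_r form a basis of the
   generic stalk; the nonempty open sets are its neighbourhoods. *)
Definition has_rank (r : nat) F : Prop :=
  exists2 U : opn, nonempty U & exists e : 'I_r -> F U,
    (forall V (VU : V `<=` U) (a : 'I_r -> regfun V), nonempty V ->
       \sum_i a i *: res F VU (e i) = 0 -> forall i, a i = 0) /\
    (forall V (s : F V), nonempty V ->
       exists2 W : opn, nonempty W &
       exists (WU : W `<=` U) (WV : W `<=` V) (a : 'I_r -> regfun W),
         res F WV s = \sum_i a i *: res F WU (e i)).

Section Jacobian.
Variables (l : nat) (f : 'I_l -> S) (e : 'I_l -> nat).
Hypothesis f_homog : forall i, f i \is (e i).-homog.

Definition jacobian : 'M[S]_(l, n.+1) := \matrix_(i, j) mderiv j (f i).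

Fact jacobian_homog i (j : 'I_n.+1) :
  homogz (((e i)%:Z - 1) - 0) (jacobian i j).
Proof.
have dP m : (jacobian i j)@_m != 0 -> e i = (mdeg m).+1.
  rewrite mxE mcoeff_deriv => cm.
  have /(dhomog_mf (f_homog i)) <- : (m + U_(j))%MM \in msupp (f i).
    by rewrite mcoeff_msupp; apply: contraNneq cm => ->; rewrite mul0rn.
  by rewrite [LHS]mdegD mdeg1 addn1.
rewrite subr0; have [->|jn0] := eqVneq (jacobian i j) 0; first by left.
right; exists (e i).-1.
  case: (e i) dP => [dP|d _]; last by rewrite intS addrAC subrr add0r.
  case/eqP: jn0; apply/mpolyP => m; rewrite mcoeff0.
  by apply/eqP/negPn/negP => /dP.
by apply/dhomogP => m; rewrite mcoeff_msupp => /dP ->.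
Qed.

Definition nabla : mor (Ofree n.+1) (dsum (fun i => Otwist ((e i)%:Z - 1))) :=
  mxmor jacobian_homog.

Definition Tsigma : pmod := kernel nabla.
End Jacobian.

Fact euler_homog (i : 'I_n.+1) : homogz (0 - (- 1)) ('X_i : S).
Proof.
by right; exists 1%N => //; rewrite dhomogX; apply/eqP; exact: mdeg1.
Qed.

Definition euler : mor (Otwist (- 1)) (Ofree n.+1) :=
  mor_tuple (fun i => polymor (euler_homog i)).

Definition theta l (f : 'I_l -> S) (e : 'I_l -> nat)
    (f_homog : forall i, f i \is (e i).-homog) F
    (phi : mor F (Tsigma f_homog)) : mor (sum2 F (Otwist (- 1))) (Ofree n.+1) :=
  copair (mor_comp (ker_incl (nabla f_homog)) phi) euler.

Definition alg_independent l (f : 'I_l -> S) : Prop :=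
  forall q : {mpoly k[l]}, q \mPo [tuple f i | i < l] = 0 -> q = 0.

End ProjectiveSpace.

(* Main.v *)
(* Everything happens at the generic point.  A frame of E there is sent by phi
   to the rows of a matrix W over the function field K, and a section s of
   T_sigma is a combination t W of these rows.  Each local form alpha on E has
   a well-defined value y = t . alpha in K, and s lifts to E, by reflexivity,
   once all these values are regular.

   The (r+1)-forms on E + O(-1) are generically multiples of one determinant,
   so the isomorphism O(c) = det (E + O(-1)) is, near a point x, multiplication
   by some lambda in K.  For constant (n+1) x r matrices A the forms
   X_j det(W A) are regular, and so are y X_j det(W A) by a Cramer identity;
   hence lambda det(W A) and y lambda det(W A) lie in the local ring S_x.
   Since W spans the kernel of the Jacobian J, det(W A) is rho times the
   minor det(A^T ; J), and the gcd g_nabla of these minors can be divided out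
   (S is factorial): m = lambda rho g_nabla and y m lie in S_x.  By Euler's
   formula every maximal minor of theta, multiplied by g_nabla, is a multiple
   of m g_sigma, so g_theta g_nabla = h g_sigma forces m to be a unit of S_x.
   Therefore y lies in S_x. *)

From HB Require Import structures.
Require Import Defs.
From mathcomp Require Import all_boot all_order all_algebra.
From mathcomp Require Import fraction.
From mathcomp Require Import mpoly.
From mathcomp Require Import ring_quotient boolp zify.

Set Implicit Arguments.
Unset Strict Implicit.
Unset Printing Implicit Defensive.

Import GRing.Theory.
Local Open Scope ring_scope.

(** * Factoriality of polynomial rings over a field *)

Section Factorial.
Variable R : idomainType.
Implicit Types a b c p q u : R.

Definition dvdr a b : Prop := exists c, b = c * a.

Definition prime_elt p : Prop :=
  [/\ p != 0, p \isn't a GRing.unit &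
      forall a b, dvdr p (a * b) -> dvdr p a \/ dvdr p b].

(** The index counts the prime factors and serves as an induction measure. The factors are primes
    rather than irreducibles, so uniqueness comes for free. *)
Inductive prime_prod : nat -> R -> Prop :=
| PrimeProdUnit u : u \is a GRing.unit -> prime_prod 0 u
| PrimeProdMul m p a : prime_elt p -> prime_prod m a -> prime_prod m.+1 (p * a).

Definition factorial_ring : Prop :=
  forall a, a != 0 -> exists m, prime_prod m a.

Lemma dvdr_mull a b c : dvdr a b -> dvdr a (c * b).
Proof. by case=> d ->; exists (c * d); rewrite mulrA. Qed.

Lemma dvdr_mulr a b c : dvdr a b -> dvdr a (b * c).
Proof. by rewrite mulrC; exact: dvdr_mull. Qed.

Lemma dvdrD a b c : dvdr a b -> dvdr a c -> dvdr a (b + c).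
Proof. by case=> d -> [e ->]; exists (d + e); rewrite mulrDl. Qed.

Lemma dvdr_sum a I (s : seq I) (P : pred I) (F : I -> R) :
  (forall i, P i -> dvdr a (F i)) -> dvdr a (\sum_(i <- s | P i) F i).
Proof.
move=> aF; apply: (big_ind (dvdr a)) => //; first by exists 0; rewrite mul0r.
exact: dvdrD.
Qed.

Lemma dvdr1 a : dvdr a 1 -> a \is a GRing.unit.
Proof. by case=> c c1; apply/unitrP; exists c; split=> //; rewrite mulrC. Qed.

Lemma prime_prod_neq0 m a : prime_prod m a -> a != 0.
Proof.
elim=> [u uu|{}m p {}a [p0 _ _] _ a0]; last by rewrite mulf_neq0.
by apply: contraTneq uu => ->; rewrite unitr0.
Qed.

Lemma prime_prod_unitM m a u :
  u \is a GRing.unit -> prime_prod m a -> prime_prod m (u * a).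
Proof.
move=> uu; elim=> [v uv|{}m p {}a pp _ IH].
  by constructor; rewrite unitrMl.
by rewrite mulrCA; constructor.
Qed.

Lemma prime_prodM m1 m2 a b :
  prime_prod m1 a -> prime_prod m2 b -> exists m, prime_prod m (a * b).
Proof.
move=> pa pb; elim: pa => [u uu|m p {}a pp _ [m' IH]].
  by exists m2; exact: prime_prod_unitM.
by exists m'.+1; rewrite -mulrA; constructor.
Qed.

Lemma prime_dvdr_prime p q : prime_elt p -> prime_elt q -> dvdr p q ->
  exists2 u, u \is a GRing.unit & q = u * p.
Proof.
move=> [p0 pu _] [q0 _ qP] [v qvp].
have [|[w vw]|[w pw]] := qP v p; first by exists 1; rewrite mul1r.
- case/negP: pu; apply: dvdr1; exists w; apply: (mulfI q0).
  by rewrite mulr1 mulrA [q * w]mulrC -vw.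
- exists v => //; apply: dvdr1; exists w; apply: (mulfI p0).
  by rewrite mulr1 [RHS]mulrC -mulrA -qvp.
Qed.

(** Induction on the factorisation of [p * a]: [p] either divides its first prime [q], and is then
    associate to it, or divides the remaining product. *)
Lemma prime_prod_div m p a : prime_elt p -> prime_prod m (p * a) ->
  exists2 m', m = m'.+1 & prime_prod m' a.
Proof.
move=> pp; move Eb: (p * a) => b pb; have [p0 pu pP] := pp.
elim: pb a Eb => [u uu|{}m q {}b qq pb IH] a Eb.
  by move: uu; rewrite -Eb unitrM (negbTE pu).
have [|pq|[c bc]] := pP q b; first by exists a; rewrite -Eb mulrC.
  have [u uu qup] := prime_dvdr_prime pp qq pq.
  exists m => //; have -> : a = u * b; last exact: prime_prod_unitM.
  by apply: (mulfI p0); rewrite Eb qup -mulrA mulrCA.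
have [|m' mm' pc] := IH c; first by rewrite mulrC.
exists m'.+1; first by rewrite mm'.
have -> : a = q * c by apply: (mulfI p0); rewrite Eb bc mulrA mulrC.
exact: PrimeProdMul.
Qed.

End Factorial.

(** * Gauss's lemma and the factoriality of R[X] *)

Section PolyFactorial.
Variable R : idomainType.
Implicit Types (c p : R) (f g : {poly R}).

Lemma dvdr_polyC p f : dvdr p%:P f <-> forall i, dvdr p f`_i.
Proof.
split=> [[g ->] i|/choice[c fc]]; first by exists g`_i; rewrite coefMC.
exists (\poly_(i < size f) c i); apply/polyP => i.
rewrite coefMC coef_poly; case: ltnP => [_|?]; first exact: fc.
by rewrite nth_default ?mul0r.
Qed.

(** If [i] and [j] are the least indices at which [p] fails to divide a coefficient of [f] and of
    [g], then modulo [p] the coefficient of index [i + j] of [f * g] is the product of these two. *)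
Lemma prime_polyC p : prime_elt p -> prime_elt p%:P.
Proof.
move=> [p0 pu pP]; split; first by rewrite polyC_eq0.
  by rewrite poly_unitE size_polyC p0 coefC eqxx.
move=> f g; case: (pselect (dvdr p%:P f)) => [|nf]; first by left.
case: (pselect (dvdr p%:P g)) => [|ng]; first by right.
have minE h : ~ dvdr p%:P h -> exists2 i, ~ dvdr p h`_i &
    forall j, (j < i)%N -> dvdr p h`_j.
  move=> nh; have : exists i, `[< ~ dvdr p h`_i >].
    apply: contrapT => all; apply: nh; apply/dvdr_polyC => i.
    by apply: contrapT => hi; apply: all; exists i; apply/asboolP.
  case/ex_minnP => i /asboolP hi mi; exists i => // j ji; apply: contrapT => hj.
  by move: ji; rewrite ltnNge mi//; apply/asboolP.
have [i fi ltfi] := minE _ nf; have [j gj ltgj] := minE _ ng.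
move=> /dvdr_polyC/(_ (i + j)%N); rewrite coefM.
have ij : (i < (i + j).+1)%N by rewrite ltnS leq_addr.
rewrite (bigD1 (Ordinal ij)) //= addKn.
set s := \sum_(_ < _ | _) _ => pfg.
have ps : dvdr p (- s).
  rewrite -mulN1r; apply/dvdr_mull/dvdr_sum => l; rewrite -val_eqE /= => li.
  case: (ltngtP l i) li => // [/ltfi pl|il] _; first exact: dvdr_mulr.
  apply/dvdr_mull/ltgj; rewrite ltn_subLR ?ltn_add2r//.
  by rewrite -ltnS.
have := dvdrD pfg ps; rewrite addrK => /pP[/fi|/gj] //.
Qed.

Lemma unit_polyC c : c \is a GRing.unit -> c%:P \is a GRing.unit.
Proof. by move=> uc; exact: rmorph_unit. Qed.

Lemma prime_prod_polyC m c : prime_prod m c -> prime_prod m c%:P.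
Proof.
elim=> [u uu|{}m p a pp _ IH]; first by constructor; exact: unit_polyC.
by rewrite polyCM; constructor => //; exact: prime_polyC.
Qed.

Definition primitive f : Prop := forall p, prime_elt p -> ~ dvdr p%:P f.

(** Each prime split off [f] is also split off its leading coefficient, whose number of prime
    factors bounds the process. *)
Lemma primitive_part m f : prime_prod m (lead_coef f) ->
  exists m' c g, [/\ prime_prod m' c, primitive g & f = c%:P * g].
Proof.
elim/ltn_ind: m f => m IH f pf.
case: (pselect (primitive f)) => [fP|].
  by exists 0, 1, f; split; rewrite ?mul1r//; constructor; exact: unitr1.
move=> nf; have [p [pp [g fg]]] : exists p, prime_elt p /\ dvdr p%:P f.
  apply: contrapT => all; apply: nf => p pp pf'; apply: all.
  by exists p; split.
have := pf; rewrite fg lead_coefM lead_coefC mulrC => /(prime_prod_div pp)[m1 mm1 pg].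
have [|m' [c [g' [pc g'P gg']]]] := IH m1 _ _ pg; first by rewrite mm1.
exists m'.+1, (p * c), g'; split=> //; first exact: PrimeProdMul.
by rewrite gg' polyCM mulrC mulrA.
Qed.

(** The primes of [c] are cancelled one at a time, each against [g] or [h] by [prime_polyC], so the
    degrees do not grow. *)
Lemma clear_prime_prod m c f g h : prime_prod m c -> c%:P * f = g * h ->
  exists g' h', [/\ f = g' * h', (size g' <= size g)%N & (size h' <= size h)%N].
Proof.
move=> pc; elim: pc f g h => [u uu|{}m p a pp _ IH] f g h fgh.
  exists (u^-1%:P * g), h; split=> //; last first.
    by rewrite size_Cmul ?invr_eq0//; apply: contraTneq uu => ->; rewrite unitr0.
  by rewrite -mulrA -fgh mulrA -polyCM mulVr ?mul1r.
have [_ _ /(_ g h) P] := prime_polyC pp.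
have p0 : p%:P != 0 by rewrite polyC_eq0; case: pp.
have [|[g1 gg1]|[h1 hh1]] := P.
- by rewrite -fgh; exists (a%:P * f); rewrite polyCM -mulrA mulrC.
- have [|g' [h' [-> sg sh]]] := IH f g1 h.
    by apply: (mulfI p0); rewrite mulrA -polyCM fgh gg1 mulrCA mulrA.
  exists g', h'; split=> //; apply: leq_trans sg _.
  by rewrite gg1 mulrC size_Cmul//; case: pp.
- have [|g' [h' [-> sg sh]]] := IH f g h1.
    by apply: (mulfI p0); rewrite mulrA -polyCM fgh hh1 mulrA mulrC.
  exists g', h'; split=> //; apply: leq_trans sh _.
  by rewrite hh1 mulrC size_Cmul//; case: pp.
Qed.

(** A prime of [c] divides [g] times the cofactor but not the primitive [g], so it cancels from the
    cofactor. *)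
Lemma primitive_dvdr m c f g : prime_prod m c -> primitive g ->
  dvdr g (c%:P * f) -> dvdr g f.
Proof.
move=> pc gP; elim: pc f => [u uu|{}m p a pp _ IH] f [q fq].
  exists (u^-1%:P * q); rewrite -mulrA -fq mulrA -polyCM mulVr ?mul1r//.
have p0 : p%:P != 0 by rewrite polyC_eq0; case: pp.
have [_ _ /(_ q g) P] := prime_polyC pp.
have [|[q1 qq1]|/gP] // := P.
  by rewrite -fq; exists (a%:P * f); rewrite polyCM -mulrA mulrC.
apply: IH; exists q1; apply: (mulfI p0).
by rewrite [LHS]mulrA -polyCM fq qq1 mulrAC mulrC.
Qed.

Lemma poly_factorial : factorial_ring R -> factorial_ring {poly R}.
Proof.
move=> UR f; have [k] := ubnP (size f); elim: k => // k IH in f *.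
rewrite ltnS => szf f0.
have [/size1_polyC fC|sz2] := leqP (size f) 1.
  move: f0; rewrite fC polyC_eq0 => /UR[m pm].
  by exists m; exact: prime_prod_polyC.
(* This is reducibility over the fraction field, with the denominators cleared into [c]. *)
case: (pselect (exists c g h, [/\ c != 0, c%:P * f = g * h,
    (size g < size f)%N & (size h < size f)%N])).
  case=> c [g [h [/UR[m pc] fgh sg sh]]].
  have [g' [h' [fgh' sg' sh']]] := clear_prime_prod pc fgh.
  move: (f0); rewrite fgh' mulf_eq0 negb_or => /andP[g0 h0].
  have [||m1 pg] := IH g' => //; first exact: leq_ltn_trans sg' (leq_trans sg szf).
  have [||m2 ph] := IH h' => //; first exact: leq_ltn_trans sh' (leq_trans sh szf).
  exact: prime_prodM pg ph.
move=> irr.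
have [|m lf] := UR (lead_coef f); first by rewrite lead_coef_eq0.
have [m' [c [g [pc gP fg]]]] := primitive_part lf.
have c0 := prime_prod_neq0 pc.
have sfg : size f = size g by rewrite fg size_Cmul.
have g0 : g != 0 by rewrite -size_poly_eq0 -sfg size_poly_eq0.
have -> : f = g * c%:P by rewrite mulrC.
exists m'.+1; constructor; last exact: prime_prod_polyC.
split=> // [|a b gab].
  by rewrite poly_unitE -sfg gtn_eqF.
(* [%|] is divisibility up to a nonzero scalar of [R], that is, over the fraction field; primitivity
   of [g] removes the scalar. *)
have dvdg h : g %| h -> dvdr g h.
  case/Pdiv.Idomain.dvdpP => -[d q] /= d0 dhq.
  have [m1 pd] := UR d d0; apply: (primitive_dvdr pd gP).
  by exists q; rewrite mul_polyC.
have dg := dvdp_gcdl g a.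
have d0 : gcdp g a != 0 by rewrite gcdp_eq0 (negbTE g0).
have [[d q] /= dn0 dq] := Pdiv.Idomain.dvdpP _ _ dg.
have q0 : q != 0.
  apply/eqP => q0; move: dq; rewrite q0 mul0r -mul_polyC => /eqP.
  by rewrite mulf_eq0 polyC_eq0 (negbTE dn0) (negbTE g0).
have szE : (size q + size (gcdp g a) = (size g).+1)%N.
  rewrite -(size_scale g dn0) dq size_mul// prednK//.
  by rewrite addn_gt0 size_poly_gt0 q0.
have sq1 : (0 < size q)%N by rewrite size_poly_gt0.
have sd1 : (0 < size (gcdp g a))%N by rewrite size_poly_gt0.
(* The gcd over the fraction field has the size of [g], and [g] divides [a]; or it is a constant,
   and [g] is coprime to [a] and divides [b]; or it is a proper factor, against [irr]. *)
have [sdg|sdg] := eqVneq (size (gcdp g a)) (size g).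
  left; apply: dvdg; have := dvdp_size_eqp dg; rewrite sdg eqxx => /esym/andP[_].
  by move=> /dvdp_trans; apply; exact: dvdp_gcdr.
have [sqg|sqg] := eqVneq (size q) (size g).
  right; apply: dvdg; rewrite -(@Gauss_dvdpr _ b a g).
    by case: gab => w ->; exact: dvdp_mull.
  by rewrite coprimep_def; move: szE; rewrite sqg -addn1 => /addnI ->.
case: irr; exists d, (c%:P * q), (gcdp g a); split=> //.
- by rewrite fg mulrCA [d%:P * g]mul_polyC dq mulrA.
- by rewrite size_Cmul// sfg; lia.
- by rewrite sfg; lia.
Qed.
End PolyFactorial.

Lemma factorial_iso (A B : idomainType) (i : {rmorphism A -> B}) :
  bijective i -> factorial_ring B -> factorial_ring A.
Proof.
move=> [j ij ji] UB.
have j_mul : {morph j : x y / x * y}.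
  by move=> x y; apply: (can_inj ij); rewrite rmorphM !ji.
have j_1 : j 1 = 1 by apply: (can_inj ij); rewrite ji rmorph1.
have j_unit u : u \is a GRing.unit -> j u \is a GRing.unit.
  move=> uu; apply/unitrP; exists (j u^-1).
  by rewrite -!j_mul divrr// mulVr.
have j_dvd a b : dvdr a b -> dvdr (j a) (j b).
  by case=> c ->; exists (j c).
have i_dvd a b : dvdr a b -> dvdr (i a) (i b).
  by case=> c ->; exists (i c); rewrite rmorphM.
have j_prime p : prime_elt p -> prime_elt (j p).
  move=> [p0 pu pP]; split.
  - by apply: contraNneq p0 => jp0; rewrite -(ji p) jp0 rmorph0.
  - by apply: contra pu => /(rmorph_unit i); rewrite ji.
  - move=> a b /i_dvd; rewrite rmorphM ji => /pP[] /j_dvd; rewrite ij; by [left|right].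
have j_prod m b : prime_prod m b -> prime_prod m (j b).
  elim=> [u uu|{}m p a pp _ IH]; first by constructor; exact: j_unit.
  by rewrite j_mul; constructor => //; exact: j_prime.
move=> a a0; have [|m pm] := UB (i a).
  by apply: contraNneq a0 => ia0; rewrite -(ij a) ia0 -(rmorph0 i) ij.
by exists m; rewrite -(ij a); exact: j_prod.
Qed.

(** * Several variables, by induction on their number *)

Section MpolyFactorial.
Variables (n : nat) (R : idomainType).
Local Notation widen := (widen_ord (leqnSn n)).

Lemma muniX (m : 'X_{1..n.+1}) : muni ('X_[R, m]) =
  'X_[[multinom m (widen i) | i < n]] *: 'X^(m ord_max).
Proof. by rewrite muniE msuppX big_seq1 mcoeffX eqxx scale1r. Qed.

Lemma muni_widen (p : {mpoly R[n]}) : muni (mwiden p) = p%:P.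
Proof.
rewrite (mpolyE p) (big_morph _ (@mwidenD n R) (@mwiden0 n R)).
rewrite (big_morph _ (@muniD n R) (@muni0 n R)).
rewrite (big_morph _ (@polyCD _) (@polyC0 _)); apply: eq_bigr => m _.
rewrite mwidenZ mwidenX muniZ muniX mnmwiden_ordmax.
rewrite expr0 scalerA alg_polyC mul_mpolyC; congr (_ *: 'X_[_])%:P.
by apply/mnmP => i; rewrite mnmE mnmwiden_widen.
Qed.

(** The inverse of [muni]: the polynomial variable becomes the last of the [n.+1] variables. *)
Let back (p : {poly {mpoly R[n]}}) := (map_poly (@mwiden n R) p).['X_ord_max].

Let back0 : back 0 = 0.
Proof. by rewrite /back raddf0 horner0. Qed.

Let backD : {morph back : p q / p + q}.
Proof. by move=> p q; rewrite /back raddfD hornerD. Qed.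

Let backZXn q i : back (q *: 'X^i) = mwiden q * 'X_ord_max ^+ i.
Proof. by rewrite /back (map_polyZ (@mwiden n R)) map_polyXn hornerZ hornerXn. Qed.

Lemma muni_bij : bijective (@muni n R).
Proof.
exists back => p.
  rewrite muniE (big_morph _ backD back0) [RHS]mpolyE; apply: eq_bigr => m _.
  rewrite backZXn mwidenZ mwidenX -scalerAl.
  congr (_ *: _); rewrite mpolyXn -mpolyXD; congr 'X_[_]; apply/mnmP => i.
  rewrite mnmDE mulmnE mnm1E; case: (unliftP ord_max i) => [j|] ->; last first.
    by rewrite mnmwiden_ordmax eqxx mul1n.
  have -> : lift ord_max j = widen j by apply: val_inj; rewrite /= /bump leqNgt ltn_ord.
  rewrite mnmwiden_widen mnmE eq_sym -val_eqE /= ltn_eqF//.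
  by rewrite mul0n addn0.
rewrite -[p]coefK poly_def (big_morph _ backD back0).
rewrite (big_morph _ (@muniD n R) (@muni0 n R)); apply: eq_bigr => i _.
rewrite backZXn muniM muni_widen mpolyXn muniX mulmnE mnm1E eqxx mul1n.
rewrite mul_polyC (_ : [multinom _ | _ < _] = 0%MM) ?mpolyX0 ?scale1r//.
apply/mnmP => j; rewrite mnmE mulmnE mnm1E mnm0E eq_sym -val_eqE /= ltn_eqF//.
Qed.
End MpolyFactorial.

Lemma mpoly_factorial (k : fieldType) n : factorial_ring {mpoly k[n]}.
Proof.
elim: n => [|n IH].
  move=> a a0; exists 0%N; constructor.
  have aC : a = (a@_0)%:MP.
    apply/mpolyP => m; rewrite mcoeffC (_ : m = 0%MM) ?eqxx ?mulr1//.
    by apply/mnmP => -[].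
  rewrite aC; apply: (rmorph_unit (@mpolyC 0 k)).
  by rewrite unitfE; apply: contraNneq a0 => a00; rewrite aC a00 mpolyC0.
exact/(factorial_iso (muni_bij n k))/poly_factorial/IH.
Qed.

(** * Localization at a point *)

Local Open Scope quotient_scope.
Lemma fraction_div (R : idomainType) (z : {fraction R}) :
  exists a b : R, b != 0 /\ z = FracField.tofrac a / FracField.tofrac b.
Proof.
elim/quotW: z => r; exists (frac r).1, (frac r).2.
have d0 := denom_ratioP r; split=> //.
have dF : FracField.tofrac (frac r).2 != 0 by rewrite tofrac_eq0.
apply: (mulIf dF); rewrite divfK//.
(* Stated with the raw multiplication of the quotient, so that [piE] can compute on
   representatives. *)
have : FracField.mul (\pi_(FracField.type R) r) (FracField.tofrac (frac r).2) =
    FracField.tofrac (frac r).1.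
  rewrite !piE /FracField.mulf !numden_Ratio ?oner_eq0// mulr1.
  apply/eqmodP; rewrite /= FracField.equivfE !numden_Ratio ?mulf_neq0 ?oner_eq0//.
  by rewrite mulr1 mulrC.
exact.
Qed.
Local Close Scope quotient_scope.

Lemma divf_Ml (F : fieldType) (z b p : F) : p != 0 -> z / b = z / (p * b) * p.
Proof. by move=> p0; rewrite invfM -mulrA mulrAC mulVf ?mul1r. Qed.

Section LocalRing.
Variables (k : fieldType) (n : nat).
Local Notation S := {mpoly k[n.+1]}.
Variables (F : fieldType) (i : {rmorphism S -> F}).
Hypothesis i_inj : injective i.
Hypothesis i_frac : forall z : F, exists a b : S, b != 0 /\ z = i a / i b.
Implicit Types (x : pt k n) (a b p q : S) (y z : F).

Lemma i_eq0 a : (i a == 0) = (a == 0).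
Proof. by rewrite -(rmorph0 i) (inj_eq i_inj). Qed.

Lemma nonvanish_poly_neq0 x a : nonvanish x a -> a != 0.
Proof. by move/nonvanish_neq0; rewrite tofrac_eq0. Qed.

Lemma nonvanish_i x a : nonvanish x a -> i a != 0.
Proof. by rewrite i_eq0; exact: nonvanish_poly_neq0. Qed.

(** The whole local ring S_x inside F, without any homogeneity condition, so that prime
    factorisations in S can be used. *)
Definition loc x z : Prop := exists a b, nonvanish x b /\ z = i a / i b.

Lemma loc_i x a : loc x (i a).
Proof. by exists a, 1; split; [exact: nonvanish1|rewrite rmorph1 divr1]. Qed.

Lemma loc_inv x b : nonvanish x b -> loc x (i b)^-1.
Proof. by move=> xb; exists 1, b; rewrite rmorph1 mul1r. Qed.

Lemma locM x y z : loc x y -> loc x z -> loc x (y * z).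
Proof.
move=> [a [b [xb ->]]] [c [d [xd ->]]]; exists (a * c), (b * d).
by split; [exact/nonvanishM|rewrite mulf_div !rmorphM].
Qed.

Lemma locD x y z : loc x y -> loc x z -> loc x (y + z).
Proof.
move=> [a [b [xb ->]]] [c [d [xd ->]]]; exists (a * d + c * b), (b * d).
split; first exact/nonvanishM.
by rewrite addf_div ?(nonvanish_i xb) ?(nonvanish_i xd)// rmorphD !rmorphM.
Qed.

Lemma locN x y : loc x y -> loc x (- y).
Proof.
by move=> [a [b [xb ->]]]; exists (- a), b; rewrite rmorphN mulNr.
Qed.

Lemma unit_nonvanish x a : a \is a GRing.unit -> nonvanish x a.
Proof.
move=> ua; have /nonvanishM[//] : nonvanish x (a * a^-1).
by rewrite divrr//; exact: nonvanish1.
Qed.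

(** Induction on the prime factors of the denominator of [y]. A prime not vanishing at [x] is
    invertible in S_x. Any other prime [p] fails to divide some [q] in [P], and [y * i q] being in
    S_x then forces [p] to divide the numerator. *)
Lemma loc_coprime x (P : S -> Prop) y :
  (forall d, (forall p, P p -> dvdmp d p) -> d \is a GRing.unit) ->
  (forall p, P p -> loc x (y * i p)) -> loc x y.
Proof.
move=> P1; have [a [b [b0 ->]]] := i_frac y; rewrite {y}.
have [m pb] := mpoly_factorial b0; rewrite {b0}.
elim: pb a => [u uu|{}m p {}b pp pb IH] a Pab.
  by apply: locM; [exact: loc_i|exact/loc_inv/unit_nonvanish].
have [p0 pu pP] := pp; have b0 := prime_prod_neq0 pb.
have pF0 : i p != 0 by rewrite i_eq0.
have bF0 : i b != 0 by rewrite i_eq0.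
have [xp|xp] := pselect (nonvanish x p).
  have E z : z / i b = z / i (p * b) * i p by rewrite rmorphM; exact: divf_Ml.
  have aE : i a / i (p * b) = i a / i b / i p by rewrite E mulfK.
  rewrite aE; apply: locM; last exact: loc_inv.
  by apply: IH => q /Pab/locM/(_ (loc_i x p)); rewrite mulrAC -E mulrAC.
have [q [Pq pq]] : exists q, P q /\ ~ dvdmp p q.
  apply: contrapT => all; case/negP: pu; apply: P1 => q Pq; apply: contrapT => pq.
  by apply: all; exists q.
have [c [s [xs]]] := Pab q Pq; have s0 := nonvanish_i xs.
rewrite mulrAC -rmorphM => /eqP; rewrite eqr_div ?i_eq0 ?mulf_neq0//; last first.
  exact: nonvanish_poly_neq0 xs.
rewrite -!rmorphM (inj_eq i_inj) => /eqP aqs.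
have [a' aa'] : dvdmp p a.
  have [|//|] := pP a (q * s).
    by exists (c * b); rewrite mulrA aqs mulrCA mulrC.
  case/pP => // -[w sw]; move: xs; rewrite sw => /nonvanishM[_ /xp] //.
have -> : i a / i (p * b) = i a' / i b.
  apply/eqP; rewrite eqr_div ?i_eq0 ?mulf_neq0// -!rmorphM aa'.
  by rewrite -mulrA.
apply: IH => r Pr; have := Pab r Pr; congr (loc x (_ * _)).
apply/eqP; rewrite eqr_div ?i_eq0 ?mulf_neq0// -!rmorphM aa'.
by rewrite -mulrA.
Qed.

(** Dividing the members of [P] by [g] leaves a family whose common divisors are units. *)
Lemma loc_gcd x (P : S -> Prop) g y : is_gcd P g -> g != 0 ->
  (forall p, P p -> loc x (y * (i p / i g))) -> loc x y.
Proof.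
move=> [gP Pg] g0 Py; apply: (@loc_coprime x (fun p => P (p * g))) => [d dP|p Pp].
  have [|c gcd] := Pg (d * g).
    move=> q Pq; have [c qcg] := gP q Pq; have [|e ced] := dP c.
      by rewrite -qcg.
    by exists e; rewrite qcg ced mulrA.
  apply: (@dvdr1 S); exists c; apply: (mulIf g0).
  by rewrite mul1r -mulrA -gcd.
by have := Py _ Pp; rewrite rmorphM mulfK ?i_eq0.
Qed.

(** The homogeneous elements of degree [d] of the graded fraction ring; poles are allowed
    anywhere. *)
Definition hfrac (d : int) z : Prop := exists a b, exists e j : nat,
  [/\ a \is e.-homog, b \is j.-homog, e%:Z = j%:Z + d, b != 0 &
      z = i a / i b].

Lemma pihomogMl d e a b : a \is d.-homog ->
  pihomog mdeg (d + e)%N (a * b) = a * pihomog mdeg e b.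
Proof.
move=> ad; set m := maxn (mmeasure mdeg b) e.+1.
rewrite {1}(@pihomog_partitionE _ _ mdeg m b) ?leq_maxl//.
have em : (e < m)%N by rewrite leq_maxr.
rewrite mulr_sumr raddf_sum (bigD1 (Ordinal em)) //= big1 ?addr0 => [|j je].
  by rewrite pihomog_dE//; apply: dhomogM => //; exact: pihomogP.
apply: (@pihomog_ne0 _ _ _ (d + j)); last by apply: dhomogM => //; exact: pihomogP.
by rewrite eqn_add2l.
Qed.

Lemma nonvanish_pihomog x b : nonvanish x b ->
  exists e, nonvanish x (pihomog mdeg e b).
Proof.
move=> xb; apply: contrapT => all; move/negP: xb; apply.
rewrite (@pihomog_partitionE _ _ mdeg _ b (leqnn _)).
have [I0 _ Il] := pt_idealP x.
apply: (big_ind (fun p => p \in pt_ideal x)) => // [p q xp xq|j _].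
  by have := Il 1 p q xp xq; rewrite mul1r.
by apply: contrapT => xj; apply: all; exists j; apply/negP.
Qed.

(** In [a * s = b * c] with [s] not vanishing at [x], one passes to homogeneous components: some
    component of [s] does not vanish at [x] either. *)
Lemma hfrac_loc d z x : hfrac d z -> loc x z -> exists a b, exists e j : nat,
  [/\ a \is e.-homog, b \is j.-homog, e%:Z = j%:Z + d, nonvanish x b &
      z = i a / i b].
Proof.
move=> [a [b [e [j [ae bj ej b0 ->]]]]] [c [s [xs]]].
move/eqP; rewrite eqr_div ?i_eq0 ?(nonvanish_poly_neq0 xs)//.
rewrite -!rmorphM (inj_eq i_inj) => /eqP asbc.
have [m xm] := nonvanish_pihomog xs.
have [l xl] := pt_relevant x.
have Xj : ('X_l ^+ j : S) \is j.-homog.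
  by rewrite -[X in X.-homog]mul1n; apply: dhomogMn; rewrite dhomogX; exact/eqP/mdeg1.
(* Without the factor ['X_l ^+ j], which does not vanish at [x], the component of [c] to be taken
   would have degree [e + m - j], possibly negative. *)
have asbc' : a * ('X_l ^+ j * s) = b * ('X_l ^+ j * c).
  by rewrite mulrCA asbc [RHS]mulrCA [b * c]mulrC.
have := congr1 (pihomog mdeg (e + (j + m))) asbc'.
rewrite pihomogMl// pihomogMl// addnCA pihomogMl// => E.
exists (pihomog mdeg (e + m) ('X_l ^+ j * c)), ('X_l ^+ j * pihomog mdeg m s).
exists (e + m)%N, (j + m)%N.
have xXm : nonvanish x ('X_l ^+ j * pihomog mdeg m s).
  by apply/nonvanishM; split=> //; exact: nonvanishXn.
split; rewrite ?pihomogP ?dhomogM ?pihomogP//; first by lia.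
apply/eqP; rewrite eqr_div ?i_eq0 ?(nonvanish_poly_neq0 xXm)//.
by rewrite -!rmorphM E mulrC.
Qed.

Lemma hfrac_tofrac d e a : a \is e.-homog -> e%:Z = d -> hfrac d (i a).
Proof.
move=> ae ed; exists a, 1, e, 0%N.
by split; rewrite ?dhomog1 ?oner_eq0 ?rmorph1 ?divr1 ?add0r.
Qed.

Lemma hfracM d d' z y : hfrac d z -> hfrac d' y -> hfrac (d + d') (z * y).
Proof.
move=> [a [b [e [j [ae bj ej b0 ->]]]]] [a' [b' [e' [j' [ae' bj' ej' b0' ->]]]]].
exists (a * a'), (b * b'), (e + e')%N, (j + j')%N.
by split; rewrite ?dhomogM ?mulf_neq0 ?mulf_div ?rmorphM//; lia.
Qed.

Lemma hfracV d z : z != 0 -> hfrac d z -> hfrac (- d) z^-1.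
Proof.
move=> z0 [a [b [e [j [ae bj ej b0 zE]]]]]; exists b, a, j, e.
split; rewrite ?zE ?invf_div//; first by lia.
by apply: contraNneq z0 => a0; rewrite zE a0 rmorph0 mul0r.
Qed.

Lemma hfracD d z y : hfrac d z -> hfrac d y -> hfrac d (z + y).
Proof.
move=> [a [b [e [j [ae bj ej b0 ->]]]]] [a' [b' [e' [j' [ae' bj' ej' b0' ->]]]]].
exists (a * b' + a' * b), (b * b'), (e + j')%N, (j + j')%N.
split; [|exact: dhomogM|by lia|by rewrite mulf_neq0|].
  apply: dhomogD; first exact: dhomogM.
  have -> : (e + j' = e' + j)%N by lia.
  exact: dhomogM.
by rewrite addf_div ?i_eq0// rmorphD !rmorphM.
Qed.

Lemma hfracN d z : hfrac d z -> hfrac d (- z).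
Proof.
move=> [a [b [e [j [ae bj ej b0 ->]]]]]; exists (- a), b, e, j.
by split; rewrite ?rpredN ?rmorphN ?mulNr.
Qed.

End LocalRing.

(** * Determinant identities *)

Definition sqmx (R : Type) (m n : nat) (e : m = n) (A : 'M[R]_(m, n)) : 'M[R]_n :=
  castmx (e, erefl n) A.

Lemma map_sqmx (R R' : Type) (f : R -> R') m n (e : m = n) (A : 'M[R]_(m, n)) :
  map_mx f (sqmx e A) = sqmx e (map_mx f A).
Proof. exact: map_castmx. Qed.

Lemma row_mxA1 (R : Type) m n2 n3 (A1 : 'cV[R]_m) (A2 : 'M_(m, n2)) (A3 : 'M_(m, n3)) :
  row_mx A1 (row_mx A2 A3) = row_mx (row_mx A1 A2) A3.
Proof.
rewrite row_mxA (_ : esym _ = erefl) ?castmx_id//; exact: eq_irrelevance.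
Qed.

Section Plucker.
Variables (F : fieldType) (r k N : nat) (e : (r + k)%N = N).
Variables (W : 'M[F]_(r, N)) (J : 'M[F]_(k, N)).
Hypotheses (Wfree : row_free W) (Jfree : row_free J) (JW : J *m W^T = 0).

(* Both identities multiply by (W^T | C) on the right, where J C = 1. *)
Lemma plucker : exists2 rho : F, rho != 0 &
  (forall A : 'M_(N, r), \det (W *m A) = rho * \det (sqmx e (col_mx A^T J))) /\
  (forall (X : 'rV_N) (B : 'M_(N, 1 + r)) (e' : (1 + r + k)%N = (1 + N)%N)
     (g : F) (v : 'cV_k), J *m X^T = g *: v ->
     \det (col_mx X W *m B) =
     rho * (- g * \det (sqmx e' (block_mx 0 B^T v J)))).
Proof.
case: N / e W J Wfree Jfree JW => W0 J0 Wf Jf JW0.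
have [C JC] := row_freeP Jf; have [A0 WA0] := row_freeP Wf.
set P := row_mx W0^T C.
have detWA (A : 'M_(r + k, r)) : \det (W0 *m A) = \det P * \det (col_mx A^T J0).
  rewrite mulrC -det_mulmx mul_col_row JW0 JC det_ublock det1 mulr1.
  by rewrite -trmx_mul det_tr.
exists (\det P); first apply/eqP => P0.
  by have /eqP := detWA A0; rewrite WA0 det1 P0 mul0r oner_eq0.
split=> [A|X B e' g v JX]; first by rewrite /sqmx castmx_id.
rewrite /sqmx (_ : e' = erefl) ?castmx_id; last exact: eq_irrelevance.
pose Z1 : 'M_(1 + (r + k)) := block_mx 0 B^T v J0.
pose Z2 : 'M_(1 + (r + k)) := block_mx (B^T *m X^T) B^T 0 J0.
(* [D] scales the first column of [Z1] by [- g]; [T] subtracts from the first column of [Z2] the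
   other columns times [X^T]. The results agree because [J0 *m X^T = g *: v]. *)
have Z12 : - g * \det Z1 = \det Z2.
  pose D : 'M_(1 + (r + k)) := block_mx (- g)%:M 0 0 1%:M.
  pose T : 'M_(1 + (r + k)) := block_mx 1%:M 0 (- X^T) 1%:M.
  have <- : \det D = - g by rewrite det_ublock det1 mulr1 det_scalar1.
  have T1 : \det T = 1 by rewrite det_lblock !det1 mulr1.
  rewrite mulrC -det_mulmx -[RHS]mulr1 -[in RHS]T1 -det_mulmx.
  congr (\det _); rewrite /Z1 /Z2 /D /T.
  rewrite (@mulmx_block _ (1 + r) k 1 (r + k) 1 (r + k)).
  rewrite (@mulmx_block _ (1 + r) k 1 (r + k) 1 (r + k)).
  rewrite !mulmx1 !mulmx0 !mul0mx !mulmxN ?add0r ?addr0 subrr JX.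
  by rewrite mul_mx_scalar scaleNr.
rewrite [X in - g * X](_ : _ = \det Z1)// Z12.
pose Q : 'M_(1 + (r + k)) := block_mx 1%:M 0 0 P.
have <- : \det Q = \det P by rewrite det_lblock det1 mul1r.
rewrite mulrC -det_mulmx.
(* The product is block upper triangular; its upper left block is the transpose of
   [col_mx X W0 *m B]. *)
have -> : Z2 *m Q =
    (block_mx (B^T *m row_mx X^T W0^T) (B^T *m C) 0 1%:M : 'M_(1 + r + k)).
  rewrite /Z2 /Q (@mulmx_block _ (1 + r) k 1 (r + k) 1 (r + k)).
  rewrite !mulmx1 !mulmx0 ?add0r ?addr0 !mul_mx_row JW0 JC /block_mx.
  rewrite -[in RHS](@row_mx0 _ k 1 r).
  exact: (congr2 (@col_mx _ (1 + r) k (1 + (r + k))) (row_mxA1 _ _ _) (row_mxA1 _ _ _)).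
apply: etrans (esym (@det_ublock F (1 + r) k _ _ _)).
by rewrite det1 mulr1 -[LHS]det_tr trmx_mul tr_col_mx.
Qed.
End Plucker.

Section Selection.
Variables (F : fieldType) (r k N : nat) (e : (r + k)%N = N).
Variable g : 'I_k -> 'I_N.
Hypothesis g_inj : injective g.

Let sel : 'M[F]_(N, k) := \matrix_(i, j) (i == g j)%:R.

Lemma mul_sel (R : pzSemiRingType) (f : {rmorphism F -> R}) m (J : 'M[R]_(m, N)) :
  J *m map_mx f sel = colsub g J.
Proof.
apply/matrixP => i j; rewrite !mxE (bigD1 (g j)) //= big1 ?addr0 => [|l lj].
  by rewrite !mxE eqxx rmorph1 mulr1.
by rewrite !mxE (negbTE lj) rmorph0 mulr0.
Qed.

Lemma selection_complement : exists (A : 'M[F]_(N, r)) (c : F),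
  forall (R : comPzRingType) (f : {rmorphism F -> R}) (J : 'M[R]_(k, N)),
  \det (colsub g J) = f c * \det (sqmx e (col_mx (map_mx f A)^T J)).
Proof.
have sel_free : row_free sel^T.
  apply/row_freeP; exists sel.
  have -> : sel^T *m sel = colsub g sel^T by rewrite -(mul_sel idfun) map_mx_id.
  by apply/matrixP => i j; rewrite !mxE (inj_eq g_inj) eq_sym.
have [A' A'free A'sel] : exists2 A' : 'M[F]_(r, N), row_free A' & A' *m sel = 0.
  have rk : \rank (kermx sel) = r.
    have /eqP := sel_free; rewrite mxrank_tr mxrank_ker => ->.
    by rewrite -e addnK.
  case: _ / rk; exists (row_base (kermx sel)); first exact: row_base_free.
  by apply/sub_kermxP; rewrite eq_row_base.
have [B AB] := row_freeP A'free.
exists A'^T, (\det (sqmx e (row_mx B sel)^T)) => R f J.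
rewrite -(mul_sel f) -det_map_mx map_sqmx.
move: B J (sel) {sel_free A'free} A'sel AB; case: N / e A' => A' B J s A's AB.
rewrite /sqmx !castmx_id !map_trmx trmxK -map_trmx det_tr map_row_mx mulrC.
rewrite -det_mulmx mul_col_row -!map_mxM A's AB map_mx0 map_mx1.
by rewrite det_lblock det1 mul1r.
Qed.
End Selection.

Lemma det_block_ul (R : comPzRingType) n (x : 'M[R]_1) (y : 'rV_n)
    (c : 'cV_n) (d : 'M_n) :
  \det (block_mx x y c d) = x 0 0 * \det d + \det (block_mx 0 y c d).
Proof.
have -> : x 0 0 * \det d = \det (block_mx x 0 c d) by rewrite det_lblock det_mx11.
rewrite -[\det (block_mx x 0 c d)]mul1r -[\det (block_mx 0 _ _ _)]mul1r.
have E (x' z : 'M_1) (y' w : 'rV_n) : row' (0 : 'I_(1 + n)) (block_mx x' y' c d) =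
    row' (0 : 'I_(1 + n)) (block_mx z w c d).
  by apply/matrixP => i j; rewrite !mxE; case: splitP => // -[[|//] ?].
apply: (@determinant_multilinear _ _ _ _ _ 0).
- apply/rowP => j; rewrite !mxE; case: splitP => // i _.
  by rewrite !mxE; case: split => l; rewrite !mul1r !mxE ?addr0 ?add0r.
- exact: E.
- exact: E.
Qed.

(* With corner entry t a instead of 0 the block matrix has rank at most r + 1. *)
Lemma cramer_extend (F : fieldType) (r : nat) (t : 'rV[F]_r) (a : 'cV[F]_r)
    (C : 'M[F]_(1 + r, r)) (u : 'cV[F]_(1 + r)) (Q : 'M[F]_r) :
  (t *m a) 0 0 * \det (row_mx u (C *m Q)) =
  - \det (block_mx 0 (row_mx 0 (t *m Q)) (C *m a) (row_mx u (C *m Q))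
          : 'M_(1 + (1 + r))).
Proof.
pose Z0 : 'M_(1 + (1 + r)) :=
  block_mx (t *m a) (row_mx 0 (t *m Q)) (C *m a) (row_mx u (C *m Q)).
have Z0E : Z0 = col_mx (row_mx 0 t) (row_mx u C) *m
    (block_mx 0 (row_mx 1%:M 0) a (row_mx 0 Q) : 'M_(1 + r, 1 + (1 + r))).
  rewrite mul_col_mx !mul_row_block !mul_mx_row !mulmx0 !mul0mx ?add0r ?mulmx1.
  by rewrite !add_row_mx ?add0r ?addr0.
have Z00 : \det Z0 = 0.
  apply/eqP; rewrite -[_ == 0]negbK -unitfE -unitmxE -row_free_unit.
  rewrite /row_free neq_ltn; apply/orP; left; rewrite Z0E.
  by rewrite ltnS (leq_trans (mxrankM_maxr _ _)) ?rank_leq_row.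
by apply/eqP; rewrite -addr_eq0 -det_block_ul; apply/eqP.
Qed.

(** Euler's formula, checked on monomials and extended by linearity. *)
Lemma mpoly_euler (R : comNzRingType) n d (p : {mpoly R[n]}) : p \is d.-homog ->
  \sum_j 'X_j * mderiv j p = d%:R *: p.
Proof.
move=> pd.
have mono (m : 'X_{1..n}) : \sum_j 'X_j * mderiv j 'X_[R, m] = (mdeg m)%:R *: 'X_[m].
  rewrite mdegE natr_sum scaler_suml; apply: eq_bigr => j _.
  rewrite mderivX -scalerAr.
  have [->|mj] := eqVneq (m j) 0%N; first by rewrite !scale0r.
  by rewrite -mpolyXD addmC submK// lep1mP.
transitivity (\sum_(m <- msupp p) p@_m *: ((mdeg m)%:R *: 'X_[m] : {mpoly R[n]})).
  rewrite [in LHS](mpolyE p).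
  under eq_bigr do rewrite raddf_sum mulr_sumr.
  rewrite exchange_big /=; apply: eq_bigr => m _.
  by rewrite -mono scaler_sumr; apply: eq_bigr => j _; rewrite mderivZ scalerAr.
rewrite [in RHS](mpolyE p) scaler_sumr big_seq [RHS]big_seq; apply: eq_bigr => m mp.
by rewrite (dhomog_mf pd mp) !scalerA mulrC.
Qed.

Section MaximalMinor.
Variables (k : fieldType) (n : nat).
Local Notation S := {mpoly k[n.+1]}.

Lemma increasing_inj m p (g : 'I_m -> 'I_p) : increasing g -> injective g.
Proof.
move=> gi a b gab; apply: val_inj; case: (ltngtP a b) => // /gi.
  by rewrite gab ltnn.
by rewrite gab ltnn.
Qed.

(** The increasing choice of rows need not be identified with the identity: its determinant is
    absorbed into [c]. *)
Lemma maximal_minorP a b (A : 'M[S]_(a, b)) (q : S) : (a <= b)%N ->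
  maximal_minor A q -> exists (g : 'I_a -> 'I_b) (c : S),
  injective g /\ q = c * \det (colsub g A).
Proof.
rewrite /maximal_minor => /minn_idPl; move: (minn a b) => m -> [f [g [_ gi ->]]].
exists g, (\det (rowsub f 1%:M)); split; first exact: increasing_inj.
rewrite -det_mulmx -rowsubE; congr (\det _).
by apply/matrixP => x y; rewrite !mxE.
Qed.

Lemma col_maximal_minor a (A : 'cV[S]_a) c : maximal_minor A (A c 0).
Proof.
have a0 : (0 < a)%N by case: a A c => // A [].
rewrite /maximal_minor (minn_idPr a0).
exists (fun=> c), (fun=> 0); split; try by move=> x y; rewrite !ord1.
by rewrite det_mx11 !mxE.
Qed.

End MaximalMinor.

(** * Values of sections at the generic point *)

(* F is the function field K of the cone, along an abstract isomorphism v with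
   inverse w: unification tends to unfold the arithmetic of K itself. *)
Section Generic.
Variables (k : fieldType) (n : nat).
Local Notation S := {mpoly k[n.+1]}.
Local Notation K := {fraction S}.
Variables (F : fieldType) (i : {rmorphism S -> F}) (v : {rmorphism K -> F}).
Variable w : F -> K.
Hypothesis wK : cancel w v.
Hypothesis v_tofrac : forall p : S, v (FracField.tofrac p) = i p.
Implicit Types (U V W : opn k n) (x : pt k n).
Local Notation "V `<=` U" := (opn_le V U) (at level 70, no associativity).

Lemma i_inj : injective i.
Proof.
by move=> a b; rewrite -!v_tofrac => /fmorph_inj/eqP; rewrite tofrac_eq => /eqP.
Qed.

Lemma i_frac z : exists a b : S, b != 0 /\ z = i a / i b.
Proof.
have [a [b [b0 wz]]] := fraction_div (w z); exists a, b; split=> //.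
by rewrite -[LHS]wK wz fmorph_div !v_tofrac.
Qed.

Let generic_ideal : {pred S} := pred1 0.

Fact generic_idealP : idealr_closed generic_ideal.
Proof.
split; rewrite ?inE ?oner_eq0// => a u t.
by rewrite !inE => /eqP -> /eqP ->; rewrite mulr0 addr0.
Qed.

Fact generic_prime : prime_idealr_closed generic_ideal.
Proof. by move=> a b; rewrite !inE mulf_eq0. Qed.

Fact generic_homog d f : f \in generic_ideal -> pihomog mdeg d f \in generic_ideal.
Proof. by rewrite !inE => /eqP ->; rewrite pihomog0. Qed.

Fact generic_relevant : exists j : 'I_n.+1, ('X_j : S) \notin generic_ideal.
Proof. by exists 0; rewrite inE -msupp_eq0 msuppX. Qed.

Definition generic_pt : pt k n :=
  Pt generic_idealP generic_prime generic_homog generic_relevant.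
Local Notation eta := generic_pt.

Lemma nonvanish_generic (p : S) : nonvanish eta p <-> p != 0.
Proof. by []. Qed.

Lemma opn_generic U x : U x -> U eta.
Proof.
move=> /opn_open[p [d [_ /nonvanish_poly_neq0 p0 pU]]].
exact/pU/nonvanish_generic.
Qed.

(** The default 0 concerns only the empty open set, since every nonempty one contains the generic
    point. *)
Definition gval d U (s : twist d U) : F :=
  match pselect (U eta) with
  | left Ueta => v (s (exist _ eta Ueta))
  | right _ => 0
  end.

Lemma gval_out d U (s : twist d U) : ~ U eta -> gval s = 0.
Proof. by rewrite /gval; case: pselect. Qed.

(** Near [x] the section is given by a single fraction on an open set, which also contains the
    generic point. *)
Lemma gvalE d U (s : twist d U) (x : opn_pt U) : v (s x) = gval s.
Proof.
have [V Vx [a [b [e [j [_ _ _ sab]]]]]] := tw_regular s x.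
have Ueta := opn_generic (svalP x); have Veta := opn_generic Vx.
rewrite /gval; case: pselect => // Ueta'; have [_ ->] := sab _ Vx.
by have [_ ->] := sab (exist _ eta Ueta') Veta.
Qed.

Lemma gval_inj d U : injective (@gval d U).
Proof.
move=> s t st; apply: tw_ext => x; apply: (fmorph_inj v).
by rewrite !gvalE.
Qed.

Lemma gval_res d U V (VU : V `<=` U) (s : twist d U) : V eta ->
  gval (tw_res VU s) = gval s.
Proof. move=> Veta; rewrite -(gvalE _ (exist _ eta Veta)).
exact: (gvalE s (opn_ptW VU (exist _ eta Veta))). Qed.

Lemma gval0 d U : gval (0 : twist d U) = 0.
Proof. by rewrite /gval; case: pselect => //= _; rewrite rmorph0. Qed.

Lemma gvalD d U (s t : twist d U) : gval (s + t) = gval s + gval t.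
Proof. by rewrite /gval; case: pselect => /= [?|_]; rewrite ?rmorphD ?addr0. Qed.

Lemma gvalN d U (s : twist d U) : gval (- s) = - gval s.
Proof. by rewrite /gval; case: pselect => /= [?|_]; rewrite ?rmorphN ?oppr0. Qed.

Lemma gvalZ d U (a : regfun U) (s : twist d U) : gval (a *: s) = gval a * gval s.
Proof. by rewrite /gval; case: pselect => /= [?|_]; rewrite ?rmorphM ?mulr0. Qed.

Lemma gvalM U (a b : regfun U) : gval (a * b) = gval a * gval b.
Proof. exact: gvalZ. Qed.

Lemma gval_polymor c d (p : S) (ph : homogz (d - c) p) U (s : twist c U) :
  gval (polymor ph U s) = i p * gval s.
Proof.
by rewrite /gval; case: pselect => /= [?|_]; rewrite ?rmorphM ?v_tofrac ?mulr0.
Qed.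

Lemma gval_frac d U (s : twist d U) x : U x -> exists a b, exists e j : nat,
  [/\ a \is e.-homog, b \is j.-homog, e%:Z = j%:Z + d, nonvanish x b &
      gval s = i a / i b].
Proof.
move=> Ux; have [V Vx [a [b [e [j [ae bj ej sab]]]]]] := tw_regular s (exist _ x Ux).
exists a, b, e, j; have [xb sE] := sab (exist _ x Ux) Vx.
by split=> //; rewrite -(gvalE _ (exist _ x Ux)) sE fmorph_div !v_tofrac.
Qed.

Lemma gval_loc d U (s : twist d U) x : U x -> loc i x (gval s).
Proof. by move=> /(gval_frac s)[a [b [e [j [_ _ _ xb sab]]]]]; exists a, b. Qed.

Lemma gval_hfrac d U (s : twist d U) : U eta -> hfrac i d (gval s).
Proof.
by move=> /(gval_frac s)[a [b [e [j [ae bj ej xb sab]]]]]; exists a, b, e, j.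
Qed.

(** The guard [U eta] makes the condition vacuous on the empty open set. *)
Definition reg d U (y : F) := U eta -> hfrac i d y /\ forall x, U x -> loc i x y.

Lemma gval_reg d U (s : twist d U) : reg d U (gval s).
Proof. by move=> Ueta; split; [exact: gval_hfrac|exact: gval_loc]. Qed.

Lemma regW d U V y : V `<=` U -> reg d U y -> reg d V y.
Proof.
move=> VU Uy Veta; have [yd Uy'] := Uy (VU _ Veta).
by split=> // x /VU; exact: Uy'.
Qed.

Lemma reg_twist d U y : reg d U y -> regular d (fun _ : opn_pt U => w y).
Proof.
move=> Uy x; have [yd Uyx] := Uy (opn_generic (svalP x)).
have [a [b [e [j [ae bj ej xb yab]]]]] := hfrac_loc i_inj yd (Uyx _ (svalP x)).
exists (opnI U (opnD bj)); first by split => //; exact: svalP.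
exists a, b, e, j; split=> // -[z Uz] [/= _ zb]; split=> //.
apply: (fmorph_inj v); rewrite wK yab fmorph_div !v_tofrac//.
Qed.

(** The default 0 keeps regularity proofs out of the arguments. *)
Definition mktw d U y : twist d U :=
  match pselect (reg d U y) with
  | left Uy => Twist (reg_twist Uy)
  | right _ => 0
  end.

Lemma gval_mktw d U y : reg d U y -> U eta -> gval (mktw d U y) = y.
Proof.
move=> Uy Ueta; rewrite /mktw; case: pselect => // Uy'.
by rewrite -(gvalE _ (exist _ eta Ueta)) /= wK.
Qed.

End Generic.

(** * Arithmetic of regular values, and vectors of generic values *)

Section Regular.
Variables (k : fieldType) (n : nat).
Local Notation S := {mpoly k[n.+1]}.
Local Notation K := {fraction S}.
Variables (F : fieldType) (i : {rmorphism S -> F}) (v : {rmorphism K -> F}).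
Hypothesis v_tofrac : forall p : S, v (FracField.tofrac p) = i p.
Implicit Types (U V W : opn k n) (x : pt k n).
Local Notation "V `<=` U" := (opn_le V U) (at level 70, no associativity).
Local Notation eta := (generic_pt k n).
Local Notation gval := (gval v).
Local Notation reg := (reg i).
Let i_inj := i_inj v_tofrac.

Lemma regD d U y z : reg d U y -> reg d U z -> reg d U (y + z).
Proof.
move=> Uy Uz Ueta; have [yd yl] := Uy Ueta; have [zd zl] := Uz Ueta.
by split=> [|x Ux]; [exact: hfracD|apply: locD => //; [exact: yl|exact: zl]].
Qed.

Lemma regN d U y : reg d U y -> reg d U (- y).
Proof.
move=> Uy Ueta; have [yd yl] := Uy Ueta.
by split=> [|x Ux]; [exact: hfracN|exact/locN/yl].
Qed.

Lemma regM c d e U y z : d + e = c -> reg d U y -> reg e U z -> reg c U (y * z).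
Proof.
move=> <- Uy Uz Ueta; have [yd yl] := Uy Ueta; have [zd zl] := Uz Ueta.
by split=> [|x Ux]; [exact: hfracM|apply: locM; [exact: yl|exact: zl]].
Qed.

Lemma reg_i d e U (p : S) : p \is e.-homog -> e%:Z = d -> reg d U (i p).
Proof.
by move=> pe ed _; split=> [|x _]; [exact: hfrac_tofrac pe ed|exact: loc_i].
Qed.

Lemma reg0 U : reg 0 U 0.
Proof. by rewrite -(rmorph0 i); apply: (@reg_i _ 0); rewrite ?dhomog0. Qed.

Lemma reg1 U : reg 0 U 1.
Proof. by rewrite -(rmorph1 i); apply: (@reg_i _ 0); rewrite ?dhomog1. Qed.

Lemma reg_const U (c : k) : reg 0 U (i c%:MP).
Proof.
by apply: (@reg_i _ 0) => //; rewrite -[c%:MP]mulr1 mul_mpolyC rpredZ// dhomog1.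
Qed.

Lemma reg_det U m (A : 'M[F]_m) : (forall a b, reg 0 U (A a b)) -> reg 0 U (\det A).
Proof.
move=> AU; rewrite /determinant; apply: big_ind; [exact: reg0|exact: regD|].
move=> s _; apply: (regM (add0r 0)).
  by case: (perm.odd_perm s); rewrite ?expr1 ?expr0; [apply: regN|]; exact: reg1.
by apply: big_ind; [exact: reg1|move=> *; exact: (regM (add0r 0))|].
Qed.

Lemma reg_mulmx U m p q (A : 'M[F]_(m, p)) (B : 'M[F]_(p, q)) :
  (forall a b, reg 0 U (A a b)) -> (forall a b, reg 0 U (B a b)) ->
  forall a b, reg 0 U ((A *m B) a b).
Proof.
move=> AU BU a b; rewrite mxE; apply: big_ind; [exact: reg0|exact: regD|].
by move=> j _; exact: (regM (add0r 0)).
Qed.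

Lemma loc_exprz x (a : S) (d : int) : nonvanish x a -> loc i x (i a ^ d).
Proof.
case: d => m xa; first by rewrite -exprnP -rmorphXn; exact: loc_i.
by rewrite NegzE -exprnN -rmorphXn; apply: loc_inv; exact: nonvanishXn.
Qed.

(** Negative powers included, these serve as local generators of O(d). *)
Lemma reg_exprz U (a : S) (d : int) : a \is 1.-homog ->
  (forall x, U x -> nonvanish x a) -> reg d U (i a ^ d).
Proof.
move=> a1 Ua Ueta; split=> [|x /Ua]; last exact: loc_exprz.
have am m : a ^+ m \is m.-homog by rewrite -[X in X.-homog]mul1n; exact: dhomogMn.
case: d => m; first by rewrite -exprnP -rmorphXn; exact: (@hfrac_tofrac _ _ _ _ _ m).
rewrite NegzE -exprnN -rmorphXn.
apply: hfracV; last exact: (@hfrac_tofrac _ _ _ _ _ m.+1).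
by rewrite (i_eq0 i_inj) expf_neq0//; exact/(nonvanish_poly_neq0 (Ua _ Ueta)).
Qed.

Definition gvec m U (s : Ofree k n m U) : 'rV[F]_m :=
  \row_j gval ((s : dprod U (fun=> Otwist k n 0)) j).

Lemma gvecD m U (s t : Ofree k n m U) : gvec (s + t) = gvec s + gvec t.
Proof. by apply/rowP => j; rewrite !mxE -gvalD. Qed.

Lemma gvecZ m U (a : regfun U) (s : Ofree k n m U) : gvec (a *: s) = gval a *: gvec s.
Proof. by apply/rowP => j; rewrite !mxE -gvalZ. Qed.

Lemma gvec_inj m U : injective (@gvec m U).
Proof.
move=> s t /rowP st; apply: dprod_ext => j; have := st j.
by rewrite !mxE; exact: gval_inj.
Qed.

Lemma gvec_res m U V (VU : V `<=` U) (s : Ofree k n m U) : V eta ->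
  gvec (res VU s) = gvec s.
Proof. by move=> Veta; apply/rowP => j; rewrite !mxE; exact: gval_res. Qed.

Lemma gvec_out m U (s : Ofree k n m U) : ~ U eta -> gvec s = 0.
Proof. by move=> Ueta; apply/rowP => j; rewrite !mxE gval_out. Qed.

Lemma gvec_reg m U (s : Ofree k n m U) a b : reg 0 U (gvec s a b).
Proof. by rewrite mxE; exact: gval_reg. Qed.

Lemma gval_sum d U I (r : seq I) P (s : I -> twist d U) :
  gval (\sum_(j <- r | P j) s j) = \sum_(j <- r | P j) gval (s j).
Proof.
apply: (big_ind2 (fun a b => gval a = b)) => [|a1 a2 b1 b2 <- <-|//].
  exact: gval0.
exact: gvalD.
Qed.

Lemma gval1 U : U eta -> gval (1 : regfun U) = 1.
Proof.
by move=> Ueta; rewrite -(gvalE v _ (exist _ eta Ueta)) /= v_tofrac rmorph1.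
Qed.

Lemma gval_det U m (A : 'M[regfun U]_m) : U eta ->
  gval (\det A) = \det (map_mx (fun a : regfun U => gval a) A).
Proof.
move=> Ueta; pose f (a : regfun U) : F := gval a.
have f_add : zmod_morphism f by move=> a b; rewrite /f gvalD gvalN.
have f_mul : monoid_morphism f by split=> [|a b]; [exact: gval1|exact: gvalM].
pose fA := GRing.isZmodMorphism.Build _ _ f f_add.
pose fM := GRing.isMonoidMorphism.Build _ _ f f_mul.
pose fR : {rmorphism regfun U -> F} := HB.pack f fA fM.
exact/esym/(det_map_mx fR).
Qed.

Section Kernel.
Variables (l : nat) (f : 'I_l -> S) (e : 'I_l -> nat).
Hypothesis f_homog : forall a, f a \is (e a).-homog.
Local Notation T := (Tsigma f_homog).

Definition kvec U (s : T U) : 'rV[F]_n.+1 := gvec (ker_val s).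

Lemma jacobian_kvec U (s : T U) : map_mx i (jacobian f) *m (kvec s)^T = 0.
Proof.
have /eqP sker := ker_valP s; apply/matrixP => a b.
rewrite !mxE /kvec /=.
have := congr1 (fun t : dsum (fun a => Otwist k n ((e a)%:Z - 1)) U => gval (t a)) sker.
rewrite [RHS]gval0 [LHS](gval_sum (index_enum _) xpredT) => E; rewrite -[RHS]E.
apply: eq_bigr => j _; rewrite !mxE (gval_polymor v_tofrac).
by congr (_ * _); rewrite !mxE.
Qed.

End Kernel.
End Regular.

(** * Forms on E + O(-1) *)

Lemma divf_cancel (F : fieldType) (a b m p t g : F) : m != 0 -> t != 0 ->
  a * b / m * (p / t) * (m * t * g) = p * b * (a * g).
Proof.
move=> m0 t0; rewrite mulf_div mulrA divfK ?mulf_neq0//.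
by rewrite [RHS](AC (2*2) (((3*2)*1)*4)).
Qed.

Section HomSec.
Variables (k : fieldType) (n : nat) (E G : pmod k n) (U : opn k n).
Variable h : hom_sec E G U.
Local Notation "V `<=` U" := (opn_le V U) (at level 70, no associativity).

Lemma hom_sec0 V (VU : V `<=` U) : h V VU 0 = 0.
Proof.
by have := hom_linear h VU (-1) 0 0; rewrite scaleN1r addNr scaleN1r addNr.
Qed.

Lemma hom_secD V (VU : V `<=` U) s t : h V VU (s + t) = h V VU s + h V VU t.
Proof. by rewrite -[s]scale1r hom_linear !scale1r. Qed.

Lemma hom_secZ V (VU : V `<=` U) a s : h V VU (a *: s) = a *: h V VU s.
Proof. by rewrite -[_ *: s]addr0 hom_linear hom_sec0 addr0. Qed.

Lemma hom_sec_sum V (VU : V `<=` U) I (r : seq I) P (s : I -> E V) :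
  h V VU (\sum_(j <- r | P j) s j) = \sum_(j <- r | P j) h V VU (s j).
Proof.
apply: (big_ind2 (fun a b => h V VU a = b)) => [|a1 a2 b1 b2 <- <-|//].
  exact: hom_sec0.
exact: hom_secD.
Qed.

End HomSec.

Section Rank.
Variables (k : fieldType) (n : nat).
Local Notation S := {mpoly k[n.+1]}.
Local Notation K := {fraction S}.
Variables (F : fieldType) (i : {rmorphism S -> F}) (v : {rmorphism K -> F}).
Variable w : F -> K.
Hypothesis wK : cancel w v.
Hypothesis v_tofrac : forall p : S, v (FracField.tofrac p) = i p.
Implicit Types (U V W : opn k n) (x : pt k n).
Local Notation "V `<=` U" := (opn_le V U) (at level 70, no associativity).
Local Notation eta := (generic_pt k n).
Local Notation gval := (gval v).
Local Notation gvec := (gvec v).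
Local Notation reg := (reg i).
Variables (l : nat) (f : 'I_l -> S) (e : 'I_l -> nat).
Hypothesis f_homog : forall a, f a \is (e a).-homog.
Variables (E : pmod k n) (phi : mor E (Tsigma f_homog)).
Local Notation EO := (sum2 E (Otwist k n (- 1))).

Lemma gval_pres d U V (VU : V `<=` U) (s : Otwist k n d U) : V eta ->
  gval (res VU s : Otwist k n d V) = gval s.
Proof. exact: gval_res. Qed.

Definition xvec : 'rV[F]_n.+1 := \row_j i 'X_j.
Definition pvec U (s : E U) : 'rV[F]_n.+1 := kvec v (phi U s).
Definition tvec U (s : EO U) : 'rV[F]_n.+1 := gvec (theta phi U s).

Lemma pvecD U (s t : E U) : pvec (s + t) = pvec s + pvec t.
Proof. by rewrite /pvec linearD -gvecD. Qed.

Lemma pvecZ U (a : regfun U) (s : E U) : pvec (a *: s) = gval a *: pvec s.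
Proof. by rewrite /pvec linearZ -gvecZ. Qed.

Lemma pvec0 U : pvec (0 : E U) = 0.
Proof. by rewrite -(scale0r (0 : E U)) pvecZ gval0 scale0r. Qed.

Lemma pvec_sum U I (r : seq I) P (s : I -> E U) :
  pvec (\sum_(j <- r | P j) s j) = \sum_(j <- r | P j) pvec (s j).
Proof.
apply: (big_ind2 (fun a b => pvec a = b)) => [|a1 a2 b1 b2 <- <-|//].
  exact: pvec0.
exact: pvecD.
Qed.

Lemma pvec_res U V (VU : V `<=` U) (s : E U) : V eta -> pvec (res VU s) = pvec s.
Proof. by move=> Veta; rewrite /pvec app_res /kvec /= gvec_res. Qed.

Lemma tvecE U (s : EO U) : tvec s = pvec s.1 + gval s.2 *: xvec.
Proof.
rewrite /tvec gvecD; congr (_ + _); apply/rowP => j.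
by rewrite !mxE (gval_polymor v_tofrac) mulrC.
Qed.

Lemma gval_minor m (g : 'I_m -> 'I_n.+1) U V (VU : V `<=` U) (s : 'I_m -> EO V) :
  V eta ->
  gval (minor_form (theta phi) g U V VU s) =
  \det (colsub g (\matrix_a tvec (s a))).
Proof.
move=> Veta; rewrite (gval_det v_tofrac _ Veta) -det_tr; congr (\det _).
by apply/matrixP => a c; rewrite !mxE.
Qed.

(** Were all these determinants zero, the minor form would vanish on D_+(X_0), whereas [psi] of the
    generator ['X_0 ^ c] pairs with it to [q] times that generator. *)
Lemma minor_neq0 m c (psi : mor (Otwist k n c) (det_sheaf m EO)) (g : 'I_m -> 'I_n.+1)
    (q : S) : q != 0 ->
  (forall U (s : Otwist k n c U) (x : opn_pt U),
    tw_val (wedge_mor (theta phi) g U (psi U s)) x = FracField.tofrac q * tw_val s x) ->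
  exists V (s : 'I_m -> EO V), V eta /\ \det (colsub g (\matrix_a tvec (s a))) != 0.
Proof.
move=> q0 psiP.
have X1 : ('X_0 : S) \is 1.-homog by rewrite dhomogX; exact/eqP/mdeg1.
have Xeta : opnD X1 eta by rewrite /= /nonvanish inE -msupp_eq0 msuppX.
have Xc : reg c (opnD X1) (i 'X_0 ^ c) by apply: (reg_exprz v_tofrac).
pose u : twist c (opnD X1) := mktw wK v_tofrac c (opnD X1) (i 'X_0 ^ c).
have uE : gval u = i 'X_0 ^ c by rewrite gval_mktw.
apply: contrapT => all0.
have form0 : minor_form (theta phi) g (opnD X1) = 0.
  apply: alt_ext => V VX s; apply: (@gval_inj _ _ _ v).
  have [Veta|Veta] := pselect (V eta); last by rewrite !gval_out.
  rewrite gval_minor// gval0; apply: contrapT => /eqP det0; apply: all0.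
  by exists V, s.
have := congr1 v (psiP _ u (exist _ eta Xeta)).
rewrite rmorphM v_tofrac !gvalE uE.
rewrite -[LHS]/(gval (hom_app (psi _ u) (@opn_le_refl _ _ _)
  (minor_form (theta phi) g (opnD X1)))).
rewrite form0 hom_sec0 gval0 => /esym/eqP.
rewrite mulf_eq0 (i_eq0 (i_inj v_tofrac)) (negbTE q0) /=; apply/negP/expfz_neq0.
by rewrite (i_eq0 (i_inj v_tofrac)) -msupp_eq0 msuppX.
Qed.

(** * Coordinates in a generic frame of E *)

Section Frame.
Variables (r : nat) (U0 : opn k n) (b : 'I_r -> E U0).
Hypothesis U0eta : U0 eta.
Hypothesis b_span : forall V (s : E V), nonempty V ->
  exists2 W : opn k n, nonempty W & exists (WU : W `<=` U0) (WV : W `<=` V)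
    (a : 'I_r -> regfun W), res WV s = \sum_j a j *: res WU (b j).

Definition frame : 'M[F]_(r, n.+1) := \matrix_a pvec (b a).

Definition opnIl U V : opnI U V `<=` U := fun x => @proj1 _ _.
Definition opnIr U V : opnI U V `<=` V := fun x => @proj2 _ _.

(* h (b a) is only defined on the intersection of V and U0, but its generic
   value is all that matters. *)
Definition dual_coord V (h : sdual E V) : 'cV[F]_r :=
  \col_a gval (hom_app h (opnIl (U:=V) (V:=U0)) (res (opnIr (U:=V) (V:=U0)) (b a))).

(** One row [c] serves [phi] and all local forms at once: everything is compared on a smaller open
    set where [s] is a combination of the [b j]. *)
Lemma coord_exists V (s : E V) : exists2 c : 'rV[F]_r, pvec s = c *m frame &
  forall V1 (VV1 : V `<=` V1) (h : sdual E V1),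
  gval (hom_app h VV1 s) = (c *m dual_coord h) 0 0.
Proof.
have [Veta|Veta] := pselect (V eta); last first.
  exists 0; first by rewrite mul0mx; exact: gvec_out.
  by move=> V1 VV1 h; rewrite mul0mx mxE gval_out.
have [W [x Wx] [WU [WV [a sa]]]] := b_span s (ex_intro _ _ Veta).
have Weta := opn_generic Wx.
exists (\row_j gval (a j)).
  rewrite -(pvec_res WV s Weta) sa pvec_sum mulmx_sum_row; apply: eq_bigr => j _.
  by rewrite pvecZ mxE rowK pvec_res.
move=> V1 VV1 h.
have VW : W `<=` V1 by move=> y /WV/VV1.
rewrite -(gval_pres WV _ Weta) -(hom_res h VV1 WV VW) sa hom_sec_sum.
rewrite (gval_sum v (index_enum _) xpredT) mxE; apply: eq_bigr => j _.
rewrite hom_secZ gvalZ !mxE; congr (_ * _).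
have WI : W `<=` opnI V1 U0 by move=> y Wy; split; [exact: (VW _ Wy)|exact: (WU _ Wy)].
rewrite -(gval_pres WI _ Weta) -(hom_res h _ WI VW).
by rewrite (res_comp _ _ WU).
Qed.

Definition big_frame : 'M[F]_(1 + r, n.+1) := col_mx xvec frame.

(** The matrix of the [tvec (s a)] factors through [big_frame], which therefore has an invertible
    square submatrix and a right inverse; the last [r] columns of the latter serve for [frame]. *)
Lemma frame_inverse V (s : 'I_(1 + r) -> EO V) (g : 'I_(1 + r) -> 'I_n.+1) :
  \det (colsub g (\matrix_a tvec (s a))) != 0 ->
  exists B : 'M[F]_(n.+1, r), frame *m B = 1%:M.
Proof.
have /choice[c sc] a : exists c : 'rV[F]_r, pvec (s a).1 = c *m frame.
  by have [c sc _] := coord_exists (s a).1; exists c.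
have -> : \matrix_a tvec (s a) =
    row_mx (\col_a gval (s a).2) (\matrix_a c a) *m big_frame.
  apply/row_matrixP => a; rewrite rowK row_mul row_row_mx rowK mul_row_col -sc.
  rewrite tvecE addrC; congr (_ + _); apply/rowP => j.
  by rewrite !mxE big_ord1 !mxE.
rewrite -mulmx_colsub det_mulmx mulf_eq0 negb_or => /andP[_ Mg].
have [Y MY] : exists Y : 'M[F]_(n.+1, 1 + r), big_frame *m Y = 1%:M.
  exists (colsub g 1%:M *m invmx (colsub g big_frame)).
  by rewrite mulmxA mulmx_colsub mulmx1 mulmxV// unitmxE unitfE.
exists (rsubmx Y); rewrite mulmx_rsub.
have -> : frame *m Y = dsubmx (big_frame *m Y).
  by rewrite mul_col_mx col_mxKd.
by rewrite MY scalar_mx_block; exact: block_mxKdr.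
Qed.

Section Coordinates.
Variable B : 'M[F]_(n.+1, r).
Hypothesis frameB : frame *m B = 1%:M.

Definition crd V (s : E V) : 'rV[F]_r := pvec s *m B.

Lemma crd_unique V (s : E V) c : pvec s = c *m frame -> crd s = c.
Proof. by rewrite /crd => ->; rewrite -mulmxA frameB mulmx1. Qed.

Lemma crd_frame V (s : E V) : pvec s = crd s *m frame.
Proof. by have [c sc _] := coord_exists s; rewrite (crd_unique sc). Qed.

Lemma gval_dual V (s : E V) V1 (VV1 : V `<=` V1) (h : sdual E V1) :
  gval (hom_app h VV1 s) = (crd s *m dual_coord h) 0 0.
Proof. by have [c sc hs] := coord_exists s; rewrite hs (crd_unique sc). Qed.

Lemma crdD V (s t : E V) : crd (s + t) = crd s + crd t.
Proof. by rewrite /crd pvecD mulmxDl. Qed.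

Lemma crdZ V (a : regfun V) (s : E V) : crd (a *: s) = gval a *: crd s.
Proof. by rewrite /crd pvecZ scalemxAl. Qed.

Lemma crd_res U V (VU : V `<=` U) (s : E U) : V eta -> crd (res VU s) = crd s.
Proof. by move=> Veta; rewrite /crd pvec_res. Qed.

Definition frow V (s : EO V) : 'rV[F]_(1 + r) := row_mx (gval s.2)%:M (crd s.1).

Definition fmx V (s : 'I_(1 + r) -> EO V) : 'M[F]_(1 + r) := \matrix_a frow (s a).

Lemma frowE V (s : EO V) : tvec s = frow s *m big_frame.
Proof. by rewrite mul_row_col -crd_frame mul_scalar_mx tvecE addrC. Qed.

Lemma fmxE V (s : 'I_(1 + r) -> EO V) : \matrix_a tvec (s a) = fmx s *m big_frame.
Proof. by apply/row_matrixP => a; rewrite rowK row_mul rowK frowE. Qed.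

Lemma frowP V (a : regfun V) (s t : EO V) :
  frow (a *: s + t) = gval a *: frow s + frow t.
Proof.
by rewrite /frow crdD crdZ gvalD gvalZ scale_row_mx add_row_mx scale_scalar_mx -raddfD.
Qed.

Lemma frow_res U V (VU : V `<=` U) (s : EO U) : V eta -> frow (res VU s) = frow s.
Proof. by move=> Veta; rewrite /frow crd_res// gval_pres. Qed.

Lemma fmx_upd V (s : 'I_(1 + r) -> EO V) a (p q : EO V) (c : regfun V) :
  \det (fmx (upd s a (c *: p + q))) =
  gval c * \det (fmx (upd s a p)) + \det (fmx (upd s a q)).
Proof.
rewrite -[\det (fmx (upd s a q))]mul1r; apply: (@determinant_multilinear _ _ _ _ _ a).
- by rewrite !rowK /upd eqxx frowP scale1r.
- by apply/matrixP => j m; rewrite !mxE /upd eq_sym (negbTE (neq_lift _ _)).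
- by apply/matrixP => j m; rewrite !mxE /upd eq_sym (negbTE (neq_lift _ _)).
Qed.

Lemma fmx_alternate V (s : 'I_(1 + r) -> EO V) a c :
  a != c -> s a = s c -> \det (fmx s) = 0.
Proof.
by move=> ac sac; apply: (determinant_alternate ac) => j; rewrite !mxE sac.
Qed.

Lemma fmx_res U V (VU : V `<=` U) (s : 'I_(1 + r) -> EO U) : V eta ->
  fmx (fun a => res VU (s a)) = fmx s.
Proof. by move=> Veta; apply/row_matrixP => a; rewrite !rowK frow_res. Qed.

(* Generically every (r+1)-form on E + O(-1) is y * det (fmx _) for some y. *)
Definition formable V y : Prop := forall V1 (V1V : V1 `<=` V) (s : 'I_(1 + r) -> EO V1),
  reg 0 V1 (y * \det (fmx s)).

Local Notation mktw := (mktw wK v_tofrac).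

#[local] Obligation Tactic := idtac.

Program Definition det_form V y (Vy : formable V y) : dual_wedge r.+1 EO V :=
  @AltSec _ _ r.+1 EO V (fun V1 V1V s => mktw 0 V1 (y * \det (fmx s))) _ _ _.
Next Obligation.
move=> V y Vy V1 V1V s a c p q; apply: (@gval_inj _ _ _ v).
have [V1eta|V1eta] := pselect (V1 eta); last by rewrite !gval_out.
rewrite gvalD gvalZ !gval_mktw//; try exact: Vy.
by rewrite fmx_upd mulrDr mulrCA.
Qed.
Next Obligation.
move=> V y Vy V1 V1V s a c ac sac; apply: (@gval_inj _ _ _ v).
have [V1eta|V1eta] := pselect (V1 eta); last by rewrite !gval_out.
rewrite gval0 gval_mktw//; last exact: Vy.
by rewrite (fmx_alternate ac sac) mulr0.
Qed.
Next Obligation.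
move=> V y Vy V1 V2 V1V V2V1 V2V s; apply: (@gval_inj _ _ _ v).
have [V2eta|V2eta] := pselect (V2 eta); last by rewrite !gval_out.
rewrite gval_pres// !gval_mktw//; try exact: Vy; last exact: V2V1.
by rewrite fmx_res.
Qed.

Lemma gval_det_form V y (Vy : formable V y) V1 (V1V : V1 `<=` V)
    (s : 'I_(1 + r) -> EO V1) :
  V1 eta -> gval (det_form Vy V1 V1V s) = y * \det (fmx s).
Proof. by move=> V1eta; rewrite gval_mktw//; exact: Vy. Qed.

Lemma formable_minor V (g : 'I_(1 + r) -> 'I_n.+1) :
  formable V (\det (colsub g big_frame)).
Proof.
move=> V1 V1V s V1eta.
have <- : gval (minor_form (theta phi) g V V1 V1V s) =
    \det (colsub g big_frame) * \det (fmx s).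
  by rewrite gval_minor// fmxE -mulmx_colsub det_mulmx mulrC.
exact: (gval_reg v_tofrac).
Qed.

Lemma minor_form_det_form V (g : 'I_(1 + r) -> 'I_n.+1) :
  minor_form (theta phi) g V = det_form (@formable_minor V g).
Proof.
apply: alt_ext => V1 V1V s; apply: (@gval_inj _ _ _ v).
have [V1eta|V1eta] := pselect (V1 eta); last by rewrite !gval_out.
by rewrite gval_det_form// gval_minor// fmxE -mulmx_colsub det_mulmx mulrC.
Qed.

Definition constant_mx (A : 'M[k]_(n.+1, r)) : 'M[F]_(n.+1, r) :=
  map_mx (i \o @mpolyC n.+1 k) A.

Lemma constant_mx_reg (A : 'M[k]_(n.+1, r)) U a c : reg 0 U (constant_mx A a c).
Proof. by rewrite mxE; exact: reg_const. Qed.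

Definition ucol V (s : 'I_(1 + r) -> EO V) : 'cV[F]_(1 + r) := \col_a gval (s a).2.

Definition cmx V (s : 'I_(1 + r) -> EO V) : 'M[F]_(1 + r, r) := \matrix_a crd (s a).1.

Lemma fmx_row V (s : 'I_(1 + r) -> EO V) : fmx s = row_mx (ucol s) (cmx s).
Proof.
apply/row_matrixP => a; rewrite rowK row_row_mx rowK; congr row_mx.
by apply/matrixP => c d; rewrite !mxE !ord1.
Qed.

(** The factors are moved into the columns: [z] of degree 1 brings the O(-1) column to degree 0, and
    [Q = frame *m constant_mx A] turns coordinates, which need not be regular, into images under
    [phi] times a constant matrix. *)
Lemma fmx_scale V (s : 'I_(1 + r) -> EO V) z (Q : 'M[F]_r) :
  z * \det Q * \det (fmx s) = \det (row_mx (z *: ucol s) (cmx s *m Q)).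
Proof.
have -> : row_mx (z *: ucol s) (cmx s *m Q) =
    row_mx (ucol s) (cmx s) *m block_mx z%:M 0 0 Q.
  by rewrite mul_row_block !mulmx0 addr0 add0r mul_mx_scalar.
by rewrite det_mulmx -fmx_row det_lblock det_scalar1 mulrC.
Qed.

Lemma ucol_reg V (s : 'I_(1 + r) -> EO V) j a c : reg 0 V ((i 'X_j *: ucol s) a c).
Proof.
rewrite !mxE; apply: (@regM _ _ _ _ _ 1 (- 1)) => //.
  by apply: (@reg_i _ _ _ _ _ 1); rewrite ?dhomogX//; exact/eqP/mdeg1.
exact: (gval_reg v_tofrac).
Qed.

Lemma cmx_frame_reg V (s : 'I_(1 + r) -> EO V) A a c :
  reg 0 V ((cmx s *m (frame *m constant_mx A)) a c).
Proof.
rewrite mulmxA; apply: (reg_mulmx v_tofrac) => a' c'; last exact: constant_mx_reg.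
have -> : (cmx s *m frame) a' c' = pvec (s a').1 0 c'.
  by rewrite crd_frame !mxE; apply: eq_bigr => j _; rewrite !mxE.
exact: (gvec_reg v_tofrac).
Qed.

Lemma row_mx_reg U m p q (M : 'M[F]_(m, p)) (N : 'M[F]_(m, q)) :
  (forall a c, reg 0 U (M a c)) -> (forall a c, reg 0 U (N a c)) ->
  forall a c, reg 0 U (row_mx M N a c).
Proof. by move=> MU NU a c; rewrite mxE; case: split. Qed.

Lemma col_mx_reg U m p q (M : 'M[F]_(m, q)) (N : 'M[F]_(p, q)) :
  (forall a c, reg 0 U (M a c)) -> (forall a c, reg 0 U (N a c)) ->
  forall a c, reg 0 U (col_mx M N a c).
Proof. by move=> MU NU a c; rewrite mxE; case: split. Qed.

Lemma zmx_reg U m p a c : reg 0 U ((0 : 'M[F]_(m, p)) a c).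
Proof. by rewrite mxE; exact: reg0. Qed.

Lemma formable_constant V j A :
  formable V (i 'X_j * \det (frame *m constant_mx A)).
Proof.
move=> V1 V1V s; rewrite fmx_scale; apply: (reg_det v_tofrac).
by apply: row_mx_reg; [exact: ucol_reg|exact: cmx_frame_reg].
Qed.

(** [cramer_extend] rewrites the product as a determinant with regular entries: [t *m frame] is the
    section [s], and [cmx u *m dual_coord h] lists the values of [h] on the E-components of [u]. *)
Lemma formable_dual U V (VU : V `<=` U) (s : Ofree k n n.+1 U) (t : 'rV[F]_r)
    (h : sdual E V) j A : gvec s = t *m frame ->
  formable V ((t *m dual_coord h) 0 0 * (i 'X_j * \det (frame *m constant_mx A))).
Proof.
move=> st V1 V1V u; rewrite -mulrA fmx_scale cramer_extend.
apply: regN; apply: (reg_det v_tofrac).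
have tU a c : reg 0 V1 ((t *m (frame *m constant_mx A)) a c).
  rewrite mulmxA -st; apply: (reg_mulmx v_tofrac) => a' c'; last exact: constant_mx_reg.
  by apply: (regW (U := U)); [move=> y /V1V/VU|exact: (gvec_reg v_tofrac)].
have hU a c : reg 0 V1 ((cmx u *m dual_coord h) a c).
  have -> : (cmx u *m dual_coord h) a c = gval (hom_app h V1V (u a).1).
    by rewrite gval_dual ord1 !mxE; apply: eq_bigr => m _; rewrite !mxE.
  exact: (gval_reg v_tofrac).
apply: col_mx_reg; apply: row_mx_reg => //; try exact: zmx_reg.
  by apply: row_mx_reg => //; exact: zmx_reg.
by apply: row_mx_reg; [exact: ucol_reg|exact: cmx_frame_reg].
Qed.

Section Nondegenerate.
Variables (V0 : opn k n) (s0 : 'I_(1 + r) -> EO V0).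
Hypotheses (V0eta : V0 eta) (s0_neq0 : \det (fmx s0) != 0).

(** Evaluation on [s0] shows that [z / y] is homogeneous of degree 0. On the open set where its
    denominator does not vanish it is a regular function relating the two forms, and [delta] is
    linear. *)
Lemma det_form_proportional V (delta : det_sheaf r.+1 EO V) y z
    (Vy : formable V y) (Vz : formable V z) : V eta -> y != 0 -> z != 0 ->
  gval (hom_app delta (@opn_le_refl _ _ V) (det_form Vz)) =
  z / y * gval (hom_app delta (@opn_le_refl _ _ V) (det_form Vy)).
Proof.
move=> Veta y0 z0.
have zy : hfrac i 0 (z / y).
  have V0eta' : opnI V V0 eta by [].
  pose s1 a := res (opnIr (U:=V) (V:=V0)) (s0 a).
  have sE : fmx s1 = fmx s0 by exact: fmx_res.
  have [zd _] := Vz _ (opnIl (U:=V) (V:=V0)) s1 V0eta'.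
  have [yd _] := Vy _ (opnIl (U:=V) (V:=V0)) s1 V0eta'.
  rewrite sE in zd yd.
  have -> : z / y = z * \det (fmx s0) / (y * \det (fmx s0)).
    by rewrite -mulf_div divff// mulr1.
  rewrite -[0]addr0 -{2}oppr0; apply: hfracM => //; apply: hfracV => //.
  by rewrite mulf_neq0.
have [p [q [c [d [pc qd cd q0 zyE]]]]] := zy.
pose V1 := opnI V (opnD qd); have V1V : V1 `<=` V := opnIl (V:=opnD qd).
have V1eta : V1 eta by split=> //; exact/nonvanish_generic.
have Vzy : reg 0 V1 (z / y).
  by move=> _; split=> // x [_ xq]; rewrite zyE; exists p, q.
pose a : regfun V1 := mktw 0 V1 (z / y).
have aE : gval a = z / y by rewrite gval_mktw.
have resE : res V1V (det_form Vz) = a *: res V1V (det_form Vy) :> dual_wedge r.+1 EO V1.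
  apply: alt_ext => V2 V2V1 s; apply: (@gval_inj _ _ _ v).
  have [V2eta|V2eta] := pselect (V2 eta); last by rewrite !gval_out.
  have formE u (Vu : formable V u) :
      gval (alt_app (res V1V (det_form Vu) : dual_wedge r.+1 EO V1) V2V1 s) =
      u * \det (fmx s).
    exact: gval_det_form.
  by rewrite [RHS]gvalZ gval_res// aE !formE mulrA divfK.
have dE u (Vu : formable V u) :
    gval (hom_app delta (@opn_le_refl _ _ V) (det_form Vu)) =
    gval (hom_app delta V1V (res V1V (det_form Vu))).
  by rewrite (hom_res delta (@opn_le_refl _ _ V) V1V V1V) gval_pres.
by rewrite !dE resE hom_secZ gvalZ aE.
Qed.

Lemma det_form_scale V (delta : det_sheaf r.+1 EO V) : V eta ->
  exists lambda, forall y (Vy : formable V y),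
  gval (hom_app delta (@opn_le_refl _ _ V) (det_form Vy)) = lambda * y.
Proof.
move=> Veta.
have d0 (Vy : formable V 0) :
    gval (hom_app delta (@opn_le_refl _ _ V) (det_form Vy)) = 0.
  rewrite (_ : det_form Vy = 0) ?hom_sec0 ?gval0//.
  apply: alt_ext => V1 V1V s; apply: (@gval_inj _ _ _ v).
  have [V1eta|V1eta] := pselect (V1 eta); last by rewrite !gval_out.
  by rewrite gval_det_form// mul0r gval0.
have [[y [Vy y0]]|all0] := pselect (exists y (Vy : formable V y), y != 0).
  exists (gval (hom_app delta (@opn_le_refl _ _ V) (det_form Vy)) / y) => z Vz.
  have [z0|z0] := eqVneq z 0; first by rewrite z0 in Vz *; rewrite d0 mulr0.
  by rewrite (det_form_proportional delta Vy)// mulrC mulrAC mulrA mulrAC.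
exists 0 => y Vy; have [y0|y0] := eqVneq y 0.
  by rewrite y0 in Vy *; rewrite d0 mulr0.
by case: all0; exists y, Vy.
Qed.

(** * Gcds of minors and regularity of the dual values *)

Section Divisor.
Hypothesis rl : (r + l)%N = n.+1.
Variables (c : int) (psi : mor (Otwist k n c) (det_sheaf r.+1 EO)).
Variables (p : ('I_r.+1 -> 'I_n.+1) -> S) (g_theta g_nabla g_sigma : S) (h : k).
Hypothesis psiP : forall g, increasing g ->
  forall U (s : Otwist k n c U) (x : opn_pt U),
  tw_val (wedge_mor (theta phi) g U (psi U s)) x = FracField.tofrac (p g) * tw_val s x.
Hypothesis g_thetaP : is_gcd (fun q => exists2 g, increasing g & q = p g) g_theta.
Hypothesis g_nablaP : is_gcd (maximal_minor (jacobian f)) g_nabla.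
Hypothesis g_sigma_dvd : forall a, dvdmp g_sigma (f a).
Hypothesis g_sigma_neq0 : g_sigma != 0.
Hypothesis h_neq0 : h != 0.
Hypothesis gcd_eq : g_theta * g_nabla = h *: g_sigma.

Let i_eq0 := i_eq0 (i_inj v_tofrac).
Let ic : {rmorphism k -> F} := i \o @mpolyC n.+1 k.
Let J : 'M[F]_(l, n.+1) := map_mx i (jacobian f).

Lemma gcd_neq0 : g_theta != 0 /\ g_nabla != 0.
Proof.
apply/andP; rewrite -negb_or -mulf_eq0 gcd_eq scaler_eq0 negb_or.
by rewrite h_neq0.
Qed.

(** Reduces statements about Jacobian minors to the determinants with constant [A], on which
    formability is known. *)
Lemma minor_stack q : maximal_minor (jacobian f) q ->
  exists (A : 'M[k]_(n.+1, r)) (d : S),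
  i q = i d * \det (sqmx rl (col_mx (constant_mx A)^T J)).
Proof.
have ln : (l <= n.+1)%N by rewrite -rl leq_addl.
case/(maximal_minorP ln) => g [d [g_inj ->]].
have [A [a Aa]] := selection_complement k rl g_inj.
exists A, (d * a%:MP); rewrite !rmorphM -mulrA -det_map_mx map_mxsub; congr (_ * _).
exact: (Aa F ic J).
Qed.

Lemma jacobian_minor_neq0 : exists2 q, maximal_minor (jacobian f) q & q != 0.
Proof.
have [_ gn0] := gcd_neq0.
apply: contrapT => all0; case/negP: gn0; have [_ gnP] := g_nablaP.
have [|d gd] := gnP 0; last by rewrite gd mulr0.
move=> q qm; exists 0; rewrite mul0r; apply: contrapT => q0; apply: all0.
by exists q => //; apply/eqP.
Qed.

Lemma jacobian_free : row_free J.
Proof.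
have [q qm q0] := jacobian_minor_neq0.
have [A [d qE]] := minor_stack qm.
have : i q != 0 by rewrite i_eq0.
rewrite qE mulf_eq0 negb_or => /andP[_]; set Z := sqmx _ _ => Z0.
have : Z \in unitmx by rewrite unitmxE unitfE.
have -> : J = rowsub (cast_ord rl \o @rshift r l) Z.
  apply/matrixP => a j; rewrite [RHS]mxE castmxE /= cast_ordK cast_ord_id.
  by rewrite col_mxEd.
move=> Zu; apply/row_freeP.
exists (invmx Z *m (rowsub (cast_ord rl \o @rshift r l) 1%:M)^T).
rewrite mulmxA mul_rowsub_mx mulmxV// mul_rowsub_mx mul1mx.
apply/matrixP => a a'; rewrite !mxE (inj_eq (inj_comp _ _)) 1?eq_sym//.
  exact: cast_ord_inj.
exact: rshift_inj.
Qed.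

Lemma jacobian_frame : J *m frame^T = 0.
Proof.
apply/matrixP => a a'; have /matrixP/(_ a 0) := jacobian_kvec v_tofrac (phi U0 (b a')).
rewrite [RHS]mxE => J0; rewrite [RHS]mxE -[RHS]J0 !mxE; apply: eq_bigr => j _.
by rewrite !mxE.
Qed.

(** By Euler's formula the entries of [J *m xvec^T] are [e a] times [f a], hence divisible by
    [g_sigma]. *)
Lemma gradient_sigma : exists d : 'cV[S]_l, J *m xvec^T = i g_sigma *: map_mx i d.
Proof.
have /choice[q fq] := g_sigma_dvd.
exists (\col_a ((e a)%:R *: q a)); apply/colP => a.
transitivity (i ((e a)%:R *: f a)); last first.
  by rewrite fq !mxE -rmorphM; congr (i _); rewrite scalerAl mulrC.
rewrite -(mpoly_euler (f_homog a)) rmorph_sum !mxE; apply: eq_bigr => j _.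
by rewrite !mxE mulrC rmorphM.
Qed.

Lemma theta_minor_neq0 : exists2 g, increasing g & p g != 0.
Proof.
have [gt0 _] := gcd_neq0.
apply: contrapT => all0; case/negP: gt0; have [_ gtP] := g_thetaP.
have [|d gd] := gtP 0; last by rewrite gd mulr0.
move=> q [g gi ->]; exists 0; rewrite mul0r; apply: contrapT => q0; apply: all0.
by exists g => //; apply/eqP.
Qed.

Lemma loc_dual V x y : V x ->
  (forall V1 (V1V : V1 `<=` V) j A,
    formable V1 (y * (i 'X_j * \det (frame *m constant_mx A)))) ->
  loc i x y.
Proof.
move=> Vx Vy; have [j xj] := pt_relevant x.
have X1 : ('X_j : S) \is 1.-homog by rewrite dhomogX; exact/eqP/mdeg1.
(* On this smaller open set ['X_j ^ c] generates O(c), and ['X_j] is a unit of S_x. *)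
pose V1 := opnI V (opnD X1); have V1x : V1 x by [].
have V1eta := opn_generic V1x.
have Xc : reg c V1 (i 'X_j ^ c) by apply: (reg_exprz v_tofrac) => // z [].
have Xj0 : i 'X_j != 0 := nonvanish_i (i_inj v_tofrac) xj.
pose u : twist c V1 := mktw c V1 (i 'X_j ^ c).
have uE : gval u = i 'X_j ^ c by rewrite gval_mktw.
(* On determinant forms the functional [psi V1 u] is multiplication by one scalar; [pE] relates it
   to the minors of theta. *)
have [lam lamE] := det_form_scale (psi V1 u) V1eta.
have pE g : increasing g -> i (p g) * i 'X_j ^ c = lam * \det (colsub g big_frame).
  move=> gi; rewrite -(lamE _ (@formable_minor V1 g)) -minor_form_det_form -uE.
  have := congr1 v (psiP gi u (exist _ x V1x)).
  by rewrite rmorphM v_tofrac !gvalE => <-.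
have lamA y' :
    (forall A, formable V1 (y' * (i 'X_j * \det (frame *m constant_mx A)))) ->
    forall A, loc i x (y' * (lam * \det (frame *m constant_mx A))).
  move=> y'V A; have -> : y' * (lam * \det (frame *m constant_mx A)) =
      lam * (y' * (i 'X_j * \det (frame *m constant_mx A))) / i 'X_j.
    by rewrite [i 'X_j * _]mulrC !mulrA mulfK// -!mulrA mulrCA.
  apply: locM; last exact: loc_inv.
  by rewrite -(lamE _ (y'V A)); exact: (gval_loc v_tofrac).
have frame_free : row_free frame by apply/row_freeP; exists B.
have [rho rho0 [plA plB]] := plucker rl frame_free jacobian_free jacobian_frame.
have [gt0 gn0] := gcd_neq0.
set m := lam * rho * i g_nabla.
have mloc y' :
    (forall A, formable V1 (y' * (i 'X_j * \det (frame *m constant_mx A)))) ->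
    loc i x (y' * m).
  move=> y'V; apply: (loc_gcd (i_inj v_tofrac) (i_frac wK v_tofrac) g_nablaP gn0).
  move=> q /minor_stack[A [d qE]].
  have -> : y' * m * (i q / i g_nabla) =
      i d * (y' * (lam * \det (frame *m constant_mx A))).
    rewrite plA qE /m; set D := \det _.
    rewrite [i d * D / _]mulrC !mulrA mulfK ?i_eq0//; congr (_ * D).
    by rewrite mulrC !mulrA.
  by apply: locM; [exact: loc_i|exact: lamA].
have ym : loc i x (y * m) by apply: mloc => A; apply: Vy; exact: opnIl.
have e' : (1 + r + l)%N = (1 + n.+1)%N by rewrite -addnA rl.
have [d Jd] := gradient_sigma.
(* The second identity of [plucker], with the Euler vector as first row, brings out the factor
   [g_sigma] of [gradient_sigma]; [D] is the polynomial determinant that remains. *)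
have pm g : increasing g -> exists D : S,
    i (p g) * i 'X_j ^ c * i g_nabla = - (m * (i g_sigma * i D)).
  move=> gi; have := plB xvec (colsub g 1%:M) e' (i g_sigma) (map_mx i d) Jd.
  rewrite mulmx_colsub mulmx1 -[col_mx _ _]/big_frame => det_g.
  exists (\det (sqmx e' (block_mx 0 (colsub g 1%:M)^T d (jacobian f)))).
  rewrite (pE _ gi) det_g -det_map_mx map_sqmx map_block_mx map_mx0 -map_trmx.
  rewrite map_mxsub map_mx1.
  set D := \det _; rewrite /m !(mulNr, mulrN); congr (- _).
  by rewrite !mulrA [RHS](ACl (1*2*4*5*3)).
have [g0 g0i pg0] := theta_minor_neq0.
have Xc0 : i 'X_j ^ c != 0 by exact: expfz_neq0.
have m0 : m != 0.
  apply/eqP => m0; have [D] := pm _ g0i; rewrite m0 mul0r oppr0 => /eqP.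
  by rewrite !mulf_eq0 !i_eq0 (negbTE pg0) (negbTE Xc0) (negbTE gn0).
have h0 : i h%:MP != 0 by rewrite i_eq0 mpolyC_eq0.
(* The relation between the gcds turns the product with each [p g / g_theta] into the polynomial
   [- D], and [loc_gcd] applies. *)
have minv : loc i x (i h%:MP * i 'X_j ^ c / m).
  apply: (loc_gcd (i_inj v_tofrac) (i_frac wK v_tofrac) g_thetaP gt0) => q [g gi ->].
  have [D pD] := pm _ gi.
  have -> : i h%:MP * i 'X_j ^ c / m * (i (p g) / i g_theta) = - i D.
    apply: (mulIf (_ : m * i g_theta * i g_sigma != 0)).
      by apply: mulf_neq0; [apply: mulf_neq0|]; rewrite ?i_eq0.
    have tn : i g_theta * i g_nabla = i h%:MP * i g_sigma.
      by rewrite -!rmorphM gcd_eq mul_mpolyC.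
    rewrite (divf_cancel _ _ _ _ m0) ?i_eq0// -tn mulrCA pD mulrN mulNr.
    by congr (- _); rewrite [RHS](AC (1*3) (3*(2*(4*1)))).
  by apply: locN; exact: loc_i.
have -> : y = y * m * (i h%:MP * i 'X_j ^ c / m) * ((i h%:MP)^-1 * i 'X_j ^ (- c)).
  by rewrite -invr_expz -invfM [_ / m]mulrC mulrA mulfK// mulfK// mulf_neq0.
apply: locM; [exact: locM|apply: locM; last exact: loc_exprz].
have hu : h \is a GRing.unit by rewrite unitfE.
apply: loc_inv; apply: unit_nonvanish; exact: (rmorph_unit (@mpolyC n.+1 k) hu).
Qed.
Lemma constant_frame_neq0 : exists A, \det (frame *m constant_mx A) != 0.
Proof.
have frame_free : row_free frame by apply/row_freeP; exists B.
have [rho rho0 [plA _]] := plucker rl frame_free jacobian_free jacobian_frame.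
have [q qm q0] := jacobian_minor_neq0; have [A [d qE]] := minor_stack qm.
exists A; rewrite plA mulf_neq0//.
by move: q0; rewrite -i_eq0 qE mulf_eq0 negb_or => /andP[].
Qed.

(** [loc_dual] settles each point. For homogeneity, [y] is written as a quotient of the values of
    two forms on [s0], with [A] chosen so that the denominator is nonzero. *)
Lemma reg_dual V y :
  (forall V1 (V1V : V1 `<=` V) j A,
    formable V1 (y * (i 'X_j * \det (frame *m constant_mx A)))) ->
  reg 0 V y.
Proof.
move=> Vy Veta; split=> [|x Vx]; last exact: loc_dual Vy.
have [A A0] := constant_frame_neq0.
set z := i 'X_0 * \det (frame *m constant_mx A).
have z0 : z != 0 by rewrite mulf_neq0// i_eq0 -msupp_eq0 msuppX.
have V1eta : opnI V V0 eta by [].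
pose s1 a := res (opnIr (U:=V) (V:=V0)) (s0 a).
have s1E : fmx s1 = fmx s0 by exact: fmx_res.
have [yd _] := Vy _ (opnIl (V:=V0)) 0 A _ (@opn_le_refl _ _ _) s1 V1eta.
have [zd _] := @formable_constant _ 0 A _ (@opn_le_refl _ _ _) s1 V1eta.
rewrite s1E -/z in yd zd.
have -> : y = y * z * \det (fmx s0) / (z * \det (fmx s0)).
  by rewrite -[y * z * _]mulrA mulfK// mulf_neq0.
rewrite -[0]addr0 -{2}oppr0; apply: hfracM => //; apply: hfracV => //.
by rewrite mulf_neq0.
Qed.

(** The independent rows of [frame] lie in the kernel of [J], whose dimension is [n.+1 - l = r], so
    they span it. *)
Lemma kvec_frame U (s : Tsigma f_homog U) : exists t : 'rV[F]_r, kvec v s = t *m frame.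
Proof.
have frame_free : row_free frame by apply/row_freeP; exists B.
have frame_ker : (frame <= kermx J^T)%MS.
  by apply/sub_kermxP; rewrite -[frame]trmxK -trmx_mul jacobian_frame trmx0.
have frame_eq : (frame == kermx J^T)%MS.
  rewrite -(geq_leqif (mxrank_leqif_eq frame_ker)) mxrank_ker mxrank_tr.
  by rewrite (eqP jacobian_free) (eqP frame_free) -rl addnK.
have [/= _ ker_frame] := andP frame_eq.
apply/submxP/(submx_trans _ ker_frame)/sub_kermxP.
by rewrite -[kvec v s]trmxK -trmx_mul (jacobian_kvec v_tofrac) trmx0.
Qed.

Lemma dual_coordP V (a : regfun V) (g g' : sdual E V) : V eta ->
  dual_coord (a *: g + g') = gval a *: dual_coord g + dual_coord g'.
Proof.
move=> Veta; apply/colP => j; rewrite !mxE [LHS]gvalD [X in X + _]gvalZ gval_res//.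
Qed.

Lemma dual_coord_restr V W (WV : W `<=` V) (g : sdual E V) : W eta ->
  dual_coord (res WV g) = dual_coord g.
Proof.
move=> Weta; apply/colP => j; rewrite !mxE.
have WV0 : opnI W U0 `<=` opnI V U0 by move=> x [/WV].
have Weta0 : opnI W U0 eta by [].
rewrite -[RHS](gval_pres WV0 _ Weta0).
rewrite -(hom_res g _ WV0 (opn_le_trans WV (opnIl (V:=U0)))).
by rewrite (res_comp _ _ (opnIr (V:=U0))).
Qed.

(** * Lifting a section of T_sigma to E through the bidual *)

Section Extension.
Variables (U : opn k n) (s : Tsigma f_homog U) (t : 'rV[F]_r).
Hypothesis st : kvec v s = t *m frame.

Lemma reg_pairing V (VU : V `<=` U) (g : sdual E V) :
  reg 0 V ((t *m dual_coord g) 0 0).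
Proof.
apply: reg_dual => V1 V1V j A V2 V2V1; apply: (formable_dual VU g j A st).
by move=> x /V2V1/V1V.
Qed.

#[local] Obligation Tactic := idtac.

(** The candidate preimage of [s]: forms are evaluated at its coordinates [t]. *)
Program Definition bidual_extension : sdual (sdual E) U :=
  @HomSec _ _ _ _ U (fun V VU g => mktw 0 V ((t *m dual_coord g) 0 0)) _ _.
Next Obligation.
move=> V VU a g g'; apply: (@gval_inj _ _ _ v).
have [Veta|Veta] := pselect (V eta); last by rewrite !gval_out.
rewrite gvalD gvalZ !gval_mktw//; try exact: reg_pairing.
by rewrite dual_coordP// mulmxDr -scalemxAr !mxE.
Qed.
Next Obligation.
move=> V W VU WV WU g; apply: (@gval_inj _ _ _ v).
have [Weta|Weta] := pselect (W eta); last by rewrite !gval_out.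
rewrite gval_pres// !gval_mktw//; try exact: reg_pairing; last exact: WV.
by rewrite dual_coord_restr.
Qed.

Program Definition phi_coord (j : 'I_n.+1) : sdual E U :=
  @HomSec _ _ _ _ U
    (fun V VU u => (ker_val (phi V u) : dprod V (fun=> Otwist k n 0)) j) _ _.
Next Obligation. by move=> j V VU a u u'; rewrite linearP. Qed.
Next Obligation. by move=> j V W VU WV WU u; rewrite /= app_res. Qed.

(* Testing against the coordinates of phi shows that the section of E whose
   bidual is bidual_extension is mapped to s. *)
Lemma phi_surj : bijective (ev E U) -> exists u, phi U u = s.
Proof.
case=> ev1 _ ev1K; exists (ev1 bidual_extension); apply: val_inj.
apply: (@gvec_inj _ _ _ v).
have [Ueta|Ueta] := pselect (U eta); last by rewrite !gvec_out.
rewrite -[RHS]/(kvec v s) st; apply/rowP => j.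
set u := ev1 _.
have uE : gval (hom_app (ev E U u) (@opn_le_refl _ _ U) (phi_coord j)) =
    gval (hom_app bidual_extension (@opn_le_refl _ _ U) (phi_coord j)).
  by rewrite /u ev1K.
have jE : dual_coord (phi_coord j) = col j frame.
  by apply/colP => a; rewrite !mxE /= app_res gval_pres.
move: uE; rewrite [RHS]gval_mktw//; last exact: reg_pairing.
rewrite jE -[LHS]/(gval ((ker_val (phi U (res _ u)) : dprod U (fun=> Otwist k n 0)) j)).
by rewrite res_id => uE; rewrite mxE [LHS]uE !mxE; apply: eq_bigr => a _; rewrite !mxE.
Qed.

End Extension.
End Divisor.

(** Equal images under [phi] give equal coordinates, hence equal values of every local form, and
    [ev E U] is injective. *)
Lemma phi_inj U : bijective (ev E U) -> injective (phi U).
Proof.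
move=> /bij_inj ev_inj s t st; apply: ev_inj; apply: hom_ext => V VU g.
apply: (@gval_inj _ _ _ v).
have [Veta|Veta] := pselect (V eta); last by rewrite !gval_out.
rewrite -[LHS]/(gval (hom_app g _ (res VU s))) -[RHS]/(gval (hom_app g _ (res VU t))).
by rewrite !gval_dual !crd_res// /crd /pvec st.
Qed.

End Nondegenerate.
End Coordinates.

End Frame.
End Rank.

Lemma iso_of_bij (k : fieldType) (n : nat) (E G : pmod k n) (f : mor E G) :
  is_iso f -> isomorphic G E.
Proof.
move=> f_iso.
have f_inv U : exists g : G U -> E U, cancel (f U) g /\ cancel g (f U).
  by have [g fK gK] := f_iso U; exists g.
pose g U := sval (cid (f_inv U)).
have fK U : cancel (f U) (g U) by rewrite /g; case: cid => ? [].
have gK U : cancel (g U) (f U) by rewrite /g; case: cid => ? [].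
have g_linear U : linear (g U).
  by move=> a s t; apply: (can_inj (fK U)); rewrite gK linearP /= !gK.
have g_res U V (VU : opn_le V U) (s : G U) : g V (res VU s) = res VU (g U s).
  by apply: (can_inj (fK V)); rewrite app_res !gK.
by exists (Mor g_linear g_res) => U; exists (f U).
Qed.

Section Main.
Variables (k : fieldType) (n : nat).
Local Notation S := {mpoly k[n.+1]}.
Local Notation K := {fraction S}.
Variables (F : fieldType) (i : {rmorphism S -> F}) (v : {rmorphism K -> F}).
Variable w : F -> K.
Hypothesis wK : cancel w v.
Hypothesis v_tofrac : forall p : S, v (FracField.tofrac p) = i p.

Lemma kernel_iso (l r : nat) (f : 'I_l -> S) (e : 'I_l -> nat)
    (f_homog : forall a, f a \is (e a).-homog)
    (E : pmod k n) (phi : mor E (Tsigma f_homog))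
    (g_theta g_nabla g_sigma : S) (h : k) :
  (r + l)%N = n.+1 -> is_iso (ev E) -> has_rank r E ->
  is_gcd_wedge r.+1 (theta phi) g_theta ->
  is_gcd (maximal_minor (jacobian f)) g_nabla ->
  (forall a, dvdmp g_sigma (f a)) -> g_sigma != 0 -> h != 0 ->
  g_theta * g_nabla = h *: g_sigma ->
  isomorphic (Tsigma f_homog) E.
Proof.
move=> rl evE [U0 [x U0x] [b [_ b_span]]] [p [c [psi [_ psiP]]] thetaP] nablaP.
move=> sigma_dvd sigma0 h0 gcdE; apply: (iso_of_bij (f := phi)) => U.
(* A nonzero minor of theta supplies in turn the sections [s0], the right inverse [B] of the frame
   and the nonzero [\det (fmx v phi B s0)]. *)
have [g gi pg] := theta_minor_neq0 thetaP sigma0 h0 gcdE.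
have U0eta := opn_generic U0x.
have [V0 [s0 [V0eta s0_minor]]] := minor_neq0 wK v_tofrac pg (psiP g gi).
have [B frameB] := frame_inverse v_tofrac b_span s0_minor.
have fmx0 : \det (fmx v phi B s0) != 0.
  move: s0_minor; rewrite (fmxE v_tofrac b_span frameB).
  by rewrite -mulmx_colsub det_mulmx mulf_eq0 negb_or => /andP[].
have injU := phi_inj b_span frameB (evE U).
have surjU s : exists u, phi U u = s.
  have [t st] := kvec_frame v_tofrac frameB rl nablaP sigma0 h0 gcdE s.
  exact: (phi_surj wK v_tofrac U0eta b_span frameB V0eta fmx0 rl psiP
    thetaP nablaP sigma_dvd sigma0 h0 gcdE st (evE U)).
have sK : cancel (fun s => sval (cid (surjU s))) (phi U).
  by move=> s; case: cid.
by exists (fun s => sval (cid (surjU s))) => // u; apply: injU; rewrite sK.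
Qed.

End Main.

Theorem theorem1 (kk : fieldType) (n k : nat) (hn : (1 <= n)%N) (hk : (1 <= k)%N)
  (f : 'I_k -> {mpoly kk[n.+1]}) (e : 'I_k -> nat)
  (f_homog : forall i, f i \is (e i).-homog)
  (f_indep : alg_independent f)
  (char_deg : forall p, p \in [pchar kk] -> forall i, ~~ (p %| e i)%N)
  (char_jac : forall p, p \in [pchar kk] ->
     \rank (map_mx (@FracField.tofrac {mpoly kk[n.+1]}) (jacobian f)) = k)
  (E : pmod kk n) (r : nat) (hr : (r + k)%N = n.+1)
  (E_reflexive : reflexive_sheaf E) (E_rank : has_rank r E)
  (phi : mor E (Tsigma f_homog))
  (g_theta g_nabla g_sigma : {mpoly kk[n.+1]})
  (g_thetaP : is_gcd_wedge r.+1 (theta phi) g_theta)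
  (g_nablaP : is_gcd (maximal_minor (jacobian f)) g_nabla)
  (g_sigmaP : is_gcd (maximal_minor (\col_i f i)) g_sigma)
  (h : kk) (h_neq0 : h != 0)
  (gcd_eq : g_theta * g_nabla = h *: g_sigma) :
  isomorphic (Tsigma f_homog) E.
Proof.
have sigma_dvd a : dvdmp g_sigma (f a).
  have [gP _] := g_sigmaP; apply: gP.
  by have := col_maximal_minor (\col_i f i) a; rewrite mxE.
have sigma_neq0 : g_sigma != 0.
  apply/eqP => g0; have [d] := sigma_dvd (Ordinal hk); rewrite g0 mulr0 => f0.
  (* If [g_sigma] were 0, this variable would be an algebraic relation among the [f i]. *)
  have /f_indep/eqP : 'X_(Ordinal hk) \mPo [tuple f i | i < k] = 0.
    by rewrite comp_mpolyXU -tnth_nth tnth_mktuple.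
  by rewrite -msupp_eq0 msuppX.
have [_ _ evE] := E_reflexive.
(* Generic values are now taken in the function field itself. *)
pose K := {fraction {mpoly kk[n.+1]}}; pose v : {rmorphism K -> K} := idfun.
exact: (@kernel_iso _ _ _ (@FracField.tofrac {mpoly kk[n.+1]}) v id _ _ _ _ _ _ _ _ _
  _ _ _ _ hr evE E_rank g_thetaP g_nablaP sigma_dvd sigma_neq0 h_neq0 gcd_eq).
Qed.
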